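(* Let $\mathbb F$ be a field, let $\mathcal A$ and $\mathcal B$ be two Bloch-Kato Lie algebras over $\mathbb F$ with $\dim_{\mathbb F}\mathcal A_1,\dim_{\mathbb F}\mathcal B_1<\infty$, and let $\mathcal L=\mathcal A\amalg\mathcal B$ be their free product. Let $\mathcal H\le\mathcal L$ be a Lie subalgebra generated by elements of degree $1$. Then $\mathcal H$ is a free product of a free Lie algebra and of some subalgebras of $\mathcal A$ and $\mathcal B$. More precisely, $$\mathcal H=\mathcal F\amalg\langle\mathcal H_1\cap\mathcal A\rangle\amalg\langle\mathcal H_1\cap\mathcal B\rangle,$$ where $\mathcal F$ is the free Lie algebra generated by $W$, for any subspace $W\le\mathcal A_1\oplus\mathcal B_1$ with $W\oplus(\mathcal H_1\cap\mathcal A)\oplus(\mathcal H_1\cap\mathcal B)=\mathcal H_1$.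
   Context: An $\mathbb N$-graded Lie algebra over $\mathbb F$ is $\mathcal L=\bigoplus_{i\ge1}\mathcal L_i$ with $[\mathcal L_n,\mathcal L_m]\subseteq\mathcal L_{n+m}$. A graded Lie algebra (or subalgebra) is $1$-generated if it is generated as a Lie algebra by elements of degree $1$. $\langle S\rangle$ denotes the Lie subalgebra generated by $S$, and $\mathcal H_1$ the degree-$1$ component of $\mathcal H$. For graded left $\mathcal U(\mathcal L)$-modules $M,N$ over the (graded) universal envelope, $\operatorname{Ext}^{i,j}_{\mathcal U(\mathcal L)}(M,N)$ is the $i$-th right derived functor (in graded modules) of $\operatorname{Hom}^j(M,N)=\{f:M\to N\ \text{linear over }\mathcal U(\mathcal L): f(M_k)\subseteq N_{k-j}\ \forall k\}$; $H^{i,j}(\mathcal L,\mathbb F)=\operatorname{Ext}^{i,j}_{\mathcal U(\mathcal L)}(\mathbb F,\mathbb F)$, with $\mathbb F$ the trivial module in degree $0$. $\mathcal L$ is Koszul if $H^{i,j}(\mathcal L,\mathbb F)=0$ for all $i\neq j$. A $1$-generated $\mathbb N$-graded Lie algebra is Bloch-Kato if all of its $1$-generated Lie subalgebras (including itself) are Koszul. The free product $\amalg$ is the coproduct in the category of $\mathbb N$-graded Lie algebras over $\mathbb F$; $\mathcal A$ and $\mathcal B$ are identified with their images in $\mathcal A\amalg\mathcal B$, so that $\mathcal L_1=\mathcal A_1\oplus\mathcal B_1$. The displayed equality means that the subalgebra $\mathcal F=\langle W\rangle$ of $\mathcal H$ is free on $W$ and that the homomorphism from the free product of the three subalgebras to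 $\mathcal H$ induced by the inclusions is an isomorphism. *)

(* Defs.v *)
From HB Require Import structures.
From mathcomp Require Import all_boot all_algebra.
From mathcomp Require Import boolp classical_sets.

Set Implicit Arguments.
Unset Strict Implicit.
Unset Printing Implicit Defensive.

Import GRing.Theory.

Local Open Scope quotient_scope.
Local Open Scope classical_set_scope.
Local Open Scope ring_scope.

(* V is the internal direct sum of the subgroups C i, i in I. *)
Definition is_grading (V : zmodType) (I : eqType) (C : I -> set V) : Prop :=
  [/\ forall i, C i 0,
      forall i x y, C i x -> C i y -> C i (x - y),
      forall x, exists s : seq I, exists2 f : I -> V,
        forall i, C i (f i) & x = \sum_(i <- s) f i &
      forall (s : seq I) (f : I -> V), uniq s -> (forall i, C i (f i)) ->
        \sum_(i <- s) f i = 0 -> forall i, i \in s -> f i = 0].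

Definition subspace (F : fieldType) (V : lmodType F) (W : set V) : Prop :=
  W 0 /\ forall (a : F) x y, W x -> W y -> W (a *: x + y).

Definition fin_dim (F : fieldType) (V : lmodType F) (W : set V) : Prop :=
  exists n (e : 'I_n -> V), forall x, W x ->
    exists c : 'I_n -> F, x = \sum_i c i *: e i.

HB.mixin Record Lmodule_isLie (F : fieldType) L of GRing.Lmodule F L := {
  lie : L -> L -> L;
  lie_linearl : forall (z : L) (a : F) (x y : L),
    lie (a *: x + y) z = a *: lie x z + lie y z;
  lie_linearr : forall (z : L) (a : F) (x y : L),
    lie z (a *: x + y) = a *: lie z x + lie z y;
  liexx : forall x : L, lie x x = 0;
  lie_jacobi : forall x y z : L,
    lie x (lie y z) + lie y (lie z x) + lie z (lie x y) = 0
}.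

#[short(type="lieType")]
HB.structure Definition LieAlgebra (F : fieldType) :=
  {L of GRing.Lmodule F L & Lmodule_isLie F L}.

(* N-graded Lie algebras: the components are indexed by all n : nat, with a
   zero component in degree 0. *)
HB.mixin Record LieAlgebra_isGraded (F : fieldType) L of LieAlgebra F L := {
  hcomp : nat -> set L;
  hcomp_grading : is_grading hcomp;
  hcompZ : forall n (a : F) (x : L), hcomp n x -> hcomp n (a *: x);
  hcomp0 : forall x : L, hcomp 0%N x -> x = 0;
  hcomp_lie : forall n m (x y : L),
    hcomp n x -> hcomp m y -> hcomp (n + m)%N (lie x y)
}.

#[short(type="gradedLieType")]
HB.structure Definition GradedLieAlgebra (F : fieldType) :=
  {L of LieAlgebra F L & LieAlgebra_isGraded F L}.

Lemma hcomp_is_grading (F : fieldType) (L : gradedLieType F) :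
  is_grading (hcomp : nat -> set L).
Proof. exact: hcomp_grading. Qed.

(* The universal envelope U(L): the unital associative algebra presented by
   the generators [ugen x], x in L, and the relations making [ugen] linear and
   [ugen [x,y] = ugen x * ugen y - ugen y * ugen x].  It is the quotient of the
   algebraic expressions [uterm L] by the least congruence [ueq] containing
   these relations and the axioms of algebras. *)
Section Envelope.
Variables (F : fieldType) (L : lieType F).

Inductive uterm : Type :=
  | UZero | UOne | UGen of L
  | UOpp of uterm | UScale of F & uterm
  | UAdd of uterm & uterm | UMul of uterm & uterm.

Inductive ueq : uterm -> uterm -> Prop :=
  | ueq_refl x : ueq x x
  | ueq_sym x y : ueq x y -> ueq y x
  | ueq_trans y x z : ueq x y -> ueq y z -> ueq x z
  | ueq_opp x y : ueq x y -> ueq (UOpp x) (UOpp y)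
  | ueq_scale a x y : ueq x y -> ueq (UScale a x) (UScale a y)
  | ueq_add x x' y y' : ueq x x' -> ueq y y' -> ueq (UAdd x y) (UAdd x' y')
  | ueq_mul x x' y y' : ueq x x' -> ueq y y' -> ueq (UMul x y) (UMul x' y')
  | ueq_addA x y z : ueq (UAdd x (UAdd y z)) (UAdd (UAdd x y) z)
  | ueq_addC x y : ueq (UAdd x y) (UAdd y x)
  | ueq_add0 x : ueq (UAdd UZero x) x
  | ueq_addN x : ueq (UAdd (UOpp x) x) UZero
  | ueq_mulA x y z : ueq (UMul x (UMul y z)) (UMul (UMul x y) z)
  | ueq_mul1l x : ueq (UMul UOne x) x
  | ueq_mul1r x : ueq (UMul x UOne) x
  | ueq_mulDl x y z : ueq (UMul (UAdd x y) z) (UAdd (UMul x z) (UMul y z))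
  | ueq_mulDr x y z : ueq (UMul x (UAdd y z)) (UAdd (UMul x y) (UMul x z))
  | ueq_scaleA a b x : ueq (UScale a (UScale b x)) (UScale (a * b) x)
  | ueq_scale1 x : ueq (UScale 1 x) x
  | ueq_scaleDr a x y :
      ueq (UScale a (UAdd x y)) (UAdd (UScale a x) (UScale a y))
  | ueq_scaleDl a b x : ueq (UScale (a + b) x) (UAdd (UScale a x) (UScale b x))
  | ueq_scaleAl a x y : ueq (UScale a (UMul x y)) (UMul (UScale a x) y)
  | ueq_scaleAr a x y : ueq (UScale a (UMul x y)) (UMul x (UScale a y))
  | ueq_gen_linear a x y :
      ueq (UGen (a *: x + y)) (UAdd (UScale a (UGen x)) (UGen y))
  | ueq_gen_lie x y :
      ueq (UGen (lie x y))
          (UAdd (UMul (UGen x) (UGen y)) (UOpp (UMul (UGen y) (UGen x)))).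

HB.instance Definition _ := gen_eqMixin uterm.
HB.instance Definition _ := gen_choiceMixin uterm.

Definition ueqb (x y : uterm) : bool := `[< ueq x y >].

Lemma ueqb_refl : reflexive ueqb.
Proof. by move=> x; apply/asboolP/ueq_refl. Qed.
Lemma ueqb_sym : symmetric ueqb.
Proof. by move=> x y; apply/asboolP/asboolP; apply: ueq_sym. Qed.
Lemma ueqb_trans : transitive ueqb.
Proof.
by move=> y x z /asboolP xy /asboolP yz; apply/asboolP/(ueq_trans xy yz).
Qed.

Canonical ueqb_equiv := EquivRel ueqb ueqb_refl ueqb_sym ueqb_trans.

Definition envelope : Type := {eq_quot ueqb}.
HB.instance Definition _ := Choice.on envelope.
HB.instance Definition _ := EqQuotient.on envelope.

Implicit Types u v w : envelope.

Definition upi (x : uterm) : envelope := \pi_envelope x.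

Lemma upiP x y : upi x = upi y <-> ueq x y.
Proof.
by split=> [/eqmodP/asboolP|xy]; last by apply/eqmodP/asboolP.
Qed.

Lemma upiK u : upi (repr u) = u.
Proof. exact: reprK. Qed.

Lemma ueq_repr x : ueq (repr (upi x)) x.
Proof. by apply/upiP; rewrite upiK. Qed.

Definition uzero : envelope := upi UZero.
Definition uone : envelope := upi UOne.
Definition uopp u : envelope := upi (UOpp (repr u)).
Definition uadd u v : envelope := upi (UAdd (repr u) (repr v)).
Definition umul u v : envelope := upi (UMul (repr u) (repr v)).
Definition uscale (a : F) u : envelope := upi (UScale a (repr u)).

Lemma upiN x : uopp (upi x) = upi (UOpp x).
Proof. by apply/upiP/ueq_opp/ueq_repr. Qed.
Lemma upiD x y : uadd (upi x) (upi y) = upi (UAdd x y).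
Proof. by apply/upiP/ueq_add; apply/ueq_repr. Qed.
Lemma upiM x y : umul (upi x) (upi y) = upi (UMul x y).
Proof. by apply/upiP/ueq_mul; apply/ueq_repr. Qed.
Lemma upiZ a x : uscale a (upi x) = upi (UScale a x).
Proof. by apply/upiP/ueq_scale/ueq_repr. Qed.

Lemma upi_ind (P : envelope -> Prop) : (forall x, P (upi x)) -> forall u, P u.
Proof. by move=> Pu u; rewrite -(upiK u). Qed.

Fact uaddA : associative uadd.
Proof.
elim/upi_ind=> x; elim/upi_ind=> y; elim/upi_ind=> z.
by rewrite !upiD; apply/upiP/ueq_addA.
Qed.
Fact uaddC : commutative uadd.
Proof.
by elim/upi_ind=> x; elim/upi_ind=> y; rewrite !upiD; apply/upiP/ueq_addC.
Qed.
Fact uadd0 : left_id uzero uadd.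
Proof. by elim/upi_ind=> x; rewrite upiD; apply/upiP/ueq_add0. Qed.
Fact uaddN : left_inverse uzero uopp uadd.
Proof. by elim/upi_ind=> x; rewrite upiN upiD; apply/upiP/ueq_addN. Qed.

HB.instance Definition _ :=
  GRing.isZmodule.Build envelope uaddA uaddC uadd0 uaddN.

Fact umulA : associative umul.
Proof.
elim/upi_ind=> x; elim/upi_ind=> y; elim/upi_ind=> z.
by rewrite !upiM; apply/upiP/ueq_mulA.
Qed.
Fact umul1l : left_id uone umul.
Proof. by elim/upi_ind=> x; rewrite upiM; apply/upiP/ueq_mul1l. Qed.
Fact umul1r : right_id uone umul.
Proof. by elim/upi_ind=> x; rewrite upiM; apply/upiP/ueq_mul1r. Qed.
Fact umulDl : left_distributive umul uadd.
Proof.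
elim/upi_ind=> x; elim/upi_ind=> y; elim/upi_ind=> z.
by rewrite upiD !upiM upiD; apply/upiP/ueq_mulDl.
Qed.
Fact umulDr : right_distributive umul uadd.
Proof.
elim/upi_ind=> x; elim/upi_ind=> y; elim/upi_ind=> z.
by rewrite upiD !upiM upiD; apply/upiP/ueq_mulDr.
Qed.

(* The value of an expression in an algebra R, given the values of the
   generators. *)
Section Eval.
Variables (R : algType F) (f : L -> R).
Fixpoint ueval (t : uterm) : R :=
  match t with
  | UZero => 0
  | UOne => 1
  | UGen x => f x
  | UOpp x => - ueval x
  | UScale a x => a *: ueval x
  | UAdd x y => ueval x + ueval y
  | UMul x y => ueval x * ueval y
  end.

Lemma ueval_ueq :
    (forall (a : F) x y, f (a *: x + y) = a *: f x + f y) ->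
    (forall x y, f (lie x y) = f x * f y - f y * f x) ->
  forall s t, ueq s t -> ueval s = ueval t.
Proof.
move=> fl fb s t; elim=> //=; do ?by move=> *; congruence.
- by move=> *; rewrite addrA.
- by move=> *; rewrite addrC.
- by move=> *; rewrite add0r.
- by move=> *; rewrite addNr.
- by move=> *; rewrite mulrA.
- by move=> *; rewrite mul1r.
- by move=> *; rewrite mulr1.
- by move=> *; rewrite mulrDl.
- by move=> *; rewrite mulrDr.
- by move=> *; rewrite scalerA.
- by move=> *; rewrite scale1r.
- by move=> *; rewrite scalerDr.
- by move=> *; rewrite scalerDl.
- by move=> *; rewrite scalerAl.
- by move=> *; rewrite scalerAr.
Qed.
End Eval.

Definition aug_gen (x : L) : F^o := 0.

(* The augmentation U(L) -> F, which kills L. *)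
Definition augmentation u : F := ueval aug_gen (repr u).

Lemma augmentation_upi x : augmentation (upi x) = ueval aug_gen x.
Proof.
apply: (@ueval_ueq F^o aug_gen _ _ _ _ (ueq_repr x)) => *; rewrite /aug_gen.
  by rewrite scaler0 addr0.
by rewrite mulr0 subr0.
Qed.

Fact uone_neq0 : uone != uzero.
Proof.
apply/eqP=> /(congr1 augmentation); rewrite !augmentation_upi => /eqP.
by rewrite /= oner_eq0.
Qed.

HB.instance Definition _ := GRing.Zmodule_isNzRing.Build envelope
  umulA umul1l umul1r umulDl umulDr uone_neq0.

Fact uscaleA a b u : uscale a (uscale b u) = uscale (a * b) u.
Proof. by elim/upi_ind: u => x; rewrite !upiZ; apply/upiP/ueq_scaleA. Qed.
Fact uscale1 : left_id 1 uscale.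
Proof. by elim/upi_ind=> x; rewrite upiZ; apply/upiP/ueq_scale1. Qed.
Fact uscaleDr : right_distributive uscale +%R.
Proof.
move=> a; elim/upi_ind=> x; elim/upi_ind=> y.
rewrite -[LHS]/(uscale a (uadd _ _)) -[RHS]/(uadd _ _).
by rewrite upiD !upiZ upiD; apply/upiP/ueq_scaleDr.
Qed.
Fact uscaleDl u : {morph uscale^~ u : a b / a + b}.
Proof.
elim/upi_ind: u => x a b /=; rewrite -[RHS]/(uadd _ _).
by rewrite !upiZ upiD; apply/upiP/ueq_scaleDl.
Qed.

HB.instance Definition _ := GRing.Zmodule_isLmodule.Build F envelope
  uscaleA uscale1 uscaleDr uscaleDl.

Fact uscaleAl a u v : a *: (u * v) = a *: u * v.
Proof.
rewrite -[LHS]/(uscale a (umul _ _)) -[RHS]/(umul (uscale _ _) _).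
elim/upi_ind: u => x; elim/upi_ind: v => y.
by rewrite upiM !upiZ upiM; apply/upiP/ueq_scaleAl.
Qed.
HB.instance Definition _ := GRing.Lmodule_isLalgebra.Build F envelope uscaleAl.

Fact uscaleAr a u v : a *: (u * v) = u * (a *: v).
Proof.
rewrite -[LHS]/(uscale a (umul _ _)) -[RHS]/(umul _ (uscale _ _)).
elim/upi_ind: u => x; elim/upi_ind: v => y.
by rewrite upiM !upiZ upiM; apply/upiP/ueq_scaleAr.
Qed.
HB.instance Definition _ := GRing.Lalgebra_isAlgebra.Build F envelope uscaleAr.

Definition ugen (x : L) : envelope := upi (UGen x).

Lemma ugen_linear (a : F) x y : ugen (a *: x + y) = a *: ugen x + ugen y.
Proof.
rewrite -[RHS]/(uadd (uscale _ _) _) upiZ upiD.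
exact/upiP/ueq_gen_linear.
Qed.

Lemma ugen_lie x y : ugen (lie x y) = ugen x * ugen y - ugen y * ugen x.
Proof.
rewrite -[RHS]/(uadd (umul _ _) (uopp (umul _ _))) !upiM upiN upiD.
exact/upiP/ueq_gen_lie.
Qed.

Fact augmentationD u v : augmentation (u + v) = augmentation u + augmentation v.
Proof.
rewrite -[u + v]/(uadd _ _); elim/upi_ind: u => x; elim/upi_ind: v => y.
by rewrite upiD !augmentation_upi.
Qed.
Fact augmentationM u v : augmentation (u * v) = augmentation u * augmentation v.
Proof.
rewrite -[u * v]/(umul _ _); elim/upi_ind: u => x; elim/upi_ind: v => y.
by rewrite upiM !augmentation_upi.
Qed.
Fact augmentation1 : augmentation 1 = 1.
Proof. by rewrite -[1]/(upi UOne) augmentation_upi. Qed.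

Lemma envelope_universal (R : algType F) (f : L -> R) :
    (forall (a : F) x y, f (a *: x + y) = a *: f x + f y) ->
    (forall x y, f (lie x y) = f x * f y - f y * f x) ->
  exists! g : envelope -> R,
    [/\ forall (a : F) u v, g (a *: u + v) = a *: g u + g v,
        g 1 = 1, forall u v, g (u * v) = g u * g v &
        forall x, g (ugen x) = f x].
Proof.
move=> fl fb.
have gE x : ueval f (repr (upi x)) = ueval f x.
  exact: (ueval_ueq fl fb (ueq_repr x)).
exists (fun u => ueval f (repr u)); split.
  split.
  - move=> a u v; rewrite -[a *: u + v]/(uadd (uscale _ _) _).
    elim/upi_ind: u => x; elim/upi_ind: v => y.
    by rewrite upiZ upiD !gE.
  - by rewrite -[1]/(upi UOne) gE.
  - move=> u v; rewrite -[u * v]/(umul _ _).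
    by elim/upi_ind: u => x; elim/upi_ind: v => y; rewrite upiM !gE.
  - by move=> x; rewrite gE.
move=> h [hl h1 hM hg]; apply/funext; elim/upi_ind=> x; rewrite gE.
have h0 : h 0 = 0.
  by have := hl (-1) 0 0; rewrite scaler0 addr0 scaleN1r addNr.
elim: x => [||x|x IHx|a x IHx|x IHx y IHy|x IHx y IHy] /=.
- by rewrite -h0.
- by rewrite -h1.
- by rewrite -hg.
- rewrite IHx -upiN -[uopp _]/(- upi x) -[- upi x]scaleN1r -[_ *: upi x]addr0.
  by rewrite hl h0 addr0 scaleN1r.
- rewrite IHx -upiZ -[uscale _ _]/(a *: upi x) -[_ *: upi x]addr0.
  by rewrite hl h0 addr0.
- rewrite IHx IHy -upiD -[uadd _ _]/(upi x + upi y).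
  by rewrite -[X in h (X + _)]scale1r hl scale1r.
- by rewrite IHx IHy -upiM -hM.
Qed.

End Envelope.

Section LieSubalgebras.
Variables (F : fieldType).

Definition lie_hom (A B : lieType F) (f : A -> B) : Prop :=
  (forall (a : F) x y, f (a *: x + y) = a *: f x + f y) /\
  (forall x y, f (lie x y) = lie (f x) (f y)).

Definition graded_lie_hom (A B : gradedLieType F) (f : A -> B) : Prop :=
  lie_hom f /\ forall n x, hcomp n x -> hcomp n (f x).

(* The Lie subalgebra <S> generated by S. *)
Inductive lie_span (L : lieType F) (S : set L) : set L :=
  | lie_span_gen x : S x -> lie_span S x
  | lie_span0 : lie_span S 0
  | lie_span_linear (a : F) x y :
      lie_span S x -> lie_span S y -> lie_span S (a *: x + y)
  | lie_span_lie x y : lie_span S x -> lie_span S y -> lie_span S (lie x y).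

Section Graded.
Variable L : gradedLieType F.

Record gradedSub : Type := GradedSub {
  sub_set :> set L;
  sub_subspace : subspace sub_set;
  sub_lie : forall x y, sub_set x -> sub_set y -> sub_set (lie x y);
  sub_homog : forall x, sub_set x -> exists s : seq nat, exists2 f : nat -> L,
    forall n, sub_set (f n) /\ hcomp n (f n) & x = \sum_(n <- s) f n
}.

(* A graded subalgebra as a graded Lie algebra, with components K `&` L_n. *)
Section SubType.
Variable K : gradedSub.

Record sub_type : Type := SubElt { sub_val : L; _ : sub_val \in sub_set K }.
HB.instance Definition _ := [isSub for sub_val].
HB.instance Definition _ := [Choice of sub_type by <:].

Fact sub_submod_closed : GRing.submod_closed (mem (sub_set K)).
Proof.
have [K0 Kl] := sub_subspace K; split=> [|a x y]; rewrite !inE //.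
exact: Kl.
Qed.
HB.instance Definition _ :=
  GRing.SubChoice_isSubLmodule.Build F L _ sub_type
    (GRing.submod_closed_semi sub_submod_closed).

Lemma sub_val0 : sub_val 0 = 0.
Proof. exact: (raddf0 (val : sub_type -> L)). Qed.
Lemma sub_val_sum (I : Type) (s : seq I) (f : I -> sub_type) :
  sub_val (\sum_(i <- s) f i) = \sum_(i <- s) sub_val (f i).
Proof. exact: (raddf_sum (val : sub_type -> L)). Qed.

Fact sub_bracket_subproof (x y : sub_type) :
  lie (val x) (val y) \in sub_set K.
Proof.
by rewrite inE; apply: sub_lie; rewrite -inE; apply: valP.
Qed.
Definition sub_bracket x y : sub_type := SubElt (sub_bracket_subproof x y).

Fact sub_linearl (z : sub_type) (a : F) (x y : sub_type) :
  sub_bracket (a *: x + y) z = a *: sub_bracket x z + sub_bracket y z.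
Proof. by apply: val_inj; rewrite /= lie_linearl. Qed.
Fact sub_linearr (z : sub_type) (a : F) (x y : sub_type) :
  sub_bracket z (a *: x + y) = a *: sub_bracket z x + sub_bracket z y.
Proof. by apply: val_inj; rewrite /= lie_linearr. Qed.
Fact sub_liexx (x : sub_type) : sub_bracket x x = 0.
Proof. by apply: val_inj; rewrite /= liexx. Qed.
Fact sub_jacobi (x y z : sub_type) :
  sub_bracket x (sub_bracket y z) + sub_bracket y (sub_bracket z x)
  + sub_bracket z (sub_bracket x y) = 0.
Proof. by apply: val_inj; rewrite /= lie_jacobi. Qed.

HB.instance Definition _ := Lmodule_isLie.Build F sub_type
  sub_linearl sub_linearr sub_liexx sub_jacobi.

Definition sub_hcomp (n : nat) : set sub_type := [set x | hcomp n (val x)].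

Fact sub_grading : is_grading sub_hcomp.
Proof.
have [C0 CB Cs Ci] := hcomp_is_grading L; split.
- by move=> n; apply: C0.
- by move=> n x y; apply: CB.
- move=> x; have /set_mem/sub_homog[s [f fK xE]] := valP x.
  have fK' n : f n \in sub_set K by rewrite inE; case: (fK n).
  exists s; exists (fun n => SubElt (fK' n)); first by move=> n; case: (fK n).
  by apply: val_inj; rewrite /= sub_val_sum.
- move=> s f us fC sum0 n ns; apply: val_inj; change (val (f n) = 0).
  apply: (Ci s (fun n => val (f n))) => //.
  by rewrite -sub_val_sum sum0 sub_val0.
Qed.
Fact sub_hcompZ n (a : F) (x : sub_type) :
  sub_hcomp n x -> sub_hcomp n (a *: x).
Proof. exact: hcompZ. Qed.
Fact sub_hcomp0 (x : sub_type) : sub_hcomp 0 x -> x = 0.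
Proof. by move=> /hcomp0 x0; apply: val_inj; rewrite x0. Qed.
Fact sub_hcomp_lie n m (x y : sub_type) :
  sub_hcomp n x -> sub_hcomp m y -> sub_hcomp (n + m) (lie x y).
Proof. exact: hcomp_lie. Qed.

HB.instance Definition _ := LieAlgebra_isGraded.Build F sub_type
  sub_grading sub_hcompZ sub_hcomp0 sub_hcomp_lie.

Definition sub_algebra : gradedLieType F := sub_type.
End SubType.

(* The subalgebra generated by the elements of degree 1 of S; it is <S> when
   S `<=` hcomp 1. *)
Section Generated.
Variable S : set L.
Let S1 : set L := S `&` hcomp 1.

Fact gen1_subspace : subspace (lie_span S1).
Proof. by split=> [|a x y]; [apply: lie_span0 | apply: lie_span_linear]. Qed.

Fact gen1_homog x : lie_span S1 x -> exists s : seq nat, exists2 f : nat -> L,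
  forall n, lie_span S1 (f n) /\ hcomp n (f n) & x = \sum_(n <- s) f n.
Proof.
have [C0 CB Cs Ci] := @hcomp_grading F L.
have CD n (u v : L) : hcomp n u -> hcomp n v -> hcomp n (u + v).
  by move=> nu nv; rewrite -[v]opprK -[- v]sub0r; apply: (CB) => //; apply: (CB).
pose Q x := exists N : nat, exists2 f : nat -> L,
  forall n, lie_span S1 (f n) /\ hcomp n (f n) & x = \sum_(n < N) f n.
suff Qx : lie_span S1 x -> Q x.
  move=> /Qx[N [f fP ->]]; exists (index_iota 0 N); exists f => //.
  by rewrite big_mkord.
have K0 n : lie_span S1 (0 : L) /\ hcomp n (0 : L).
  by split; [apply: lie_span0 | apply: C0].
have Q0 : Q 0 by exists 0%N; exists (fun=> 0); rewrite ?big_ord0.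
have Qlin (a : F) u v : Q u -> Q v -> Q (a *: u + v).
  move=> [N [f fP ->]] [M [g gP ->]]; exists (maxn N M).
  exists (fun n => a *: (if (n < N)%N then f n else 0)
                   + (if (n < M)%N then g n else 0)).
    move=> n; have [fK fn] : lie_span S1 (if (n < N)%N then f n else 0) /\
        hcomp n (if (n < N)%N then f n else 0) by case: ifP.
    have [gK gn] : lie_span S1 (if (n < M)%N then g n else 0) /\
        hcomp n (if (n < M)%N then g n else 0) by case: ifP.
    by split; [apply: lie_span_linear | apply: CD => //; apply: hcompZ].
  rewrite big_split /= -scaler_sumr -!big_mkcond /=.
  rewrite -(big_ord_widen _ f) ?leq_maxl //.
  by rewrite -(big_ord_widen _ g) ?leq_maxr.
have Qsum N (f : nat -> L) : (forall n : nat, Q (f n)) -> Q (\sum_(n < N) f n).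
  move=> fQ; elim: N => [|N IHN]; first by rewrite big_ord0.
  by rewrite big_ord_recr /= -[X in X + _]scale1r; apply: Qlin.
have Qhom n u : lie_span S1 u -> hcomp n u -> Q u.
  move=> uK un; exists n.+1, (fun i => if i == n then u else 0).
    by move=> i; case: eqP => [->|].
  rewrite big_ord_recr /= eqxx big1 ?add0r // => i _.
  by rewrite ltn_eqF.
elim=> {x} [x [xS x1]||a x y _ Qx _ Qy|x y _ [N [f fP ->]] _ [M [g gP ->]]] //.
- by apply: (Qhom 1%N) => //; apply: lie_span_gen.
- exact: Qlin.
have lie0l (v : L) : lie 0 v = 0.
  have := lie_linearl v (-1) 0 0.
  by rewrite scaler0 addr0 scaleN1r addNr.
have lie0r (v : L) : lie v 0 = 0.
  have := lie_linearr v (-1) 0 0.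
  by rewrite scaler0 addr0 scaleN1r addNr.
have -> : lie (\sum_(n < N) f n) (\sum_(m < M) g m) =
    \sum_(n < N) \sum_(m < M) lie (f n) (g m).
  elim: N => [|N IHN]; first by rewrite !big_ord0 lie0l.
  rewrite !big_ord_recr /= -IHN -[X in lie (X + _)]scale1r lie_linearl scale1r.
  congr (_ + _); elim: M {IHN} => [|M IHM]; first by rewrite !big_ord0 lie0r.
  rewrite !big_ord_recr /= -IHM.
  by rewrite -[X in lie _ (X + _)]scale1r lie_linearr scale1r.
apply: (Qsum N (fun n => \sum_(m < M) lie (f n) (g m))) => n.
apply: (Qsum M (fun m => lie (f n) (g m))) => m.
have [[fK fn] [gK gm]] := (fP n, gP m).
by apply: (Qhom (n + m)%N); [apply: lie_span_lie | apply: hcomp_lie].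
Qed.

Definition gen1 : gradedSub :=
  GradedSub gen1_subspace (@lie_span_lie L S1) gen1_homog.

End Generated.

End Graded.
End LieSubalgebras.

Section Cohomology.
Variables (F : fieldType) (L : gradedLieType F).

(* The component U(L)_n, n >= 0, of the graded universal envelope. *)
Inductive ucomp : nat -> set (envelope L) :=
  | ucomp_zero n : ucomp n 0
  | ucomp_linear n (a : F) u v :
      ucomp n u -> ucomp n v -> ucomp n (a *: u + v)
  | ucomp_one : ucomp 0 1
  | ucomp_gen n (x : L) : hcomp n x -> ucomp n (ugen x)
  | ucomp_mul n m u v : ucomp n u -> ucomp m v -> ucomp (n + m) (u * v).

(* Graded left U(L)-modules; the gradings are indexed by Z. *)
Record gmod : Type := GMod {
  gmod_sort :> lmodType (envelope L);
  gcomp : int -> set gmod_sort;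
  gcomp_grading : is_grading gcomp;
  gcomp_act : forall n k u x,
    ucomp n u -> gcomp k x -> gcomp (n%:Z + k) (u *: x)
}.
Arguments gcomp : clear implicits.

(* The elements of Hom^j(M, N). *)
Definition ghom (j : int) (M N : gmod) (f : M -> N) : Prop :=
  (forall u x y, f (u *: x + y) = u *: f x + f y) /\
  (forall k x, gcomp M k x -> gcomp N (k - j) (f x)).

(* The morphisms of graded modules are the elements of Hom^0. *)
Definition gprojective (P : gmod) : Prop :=
  forall (M N : gmod) (p : M -> N) (f : P -> N),
    ghom 0 p -> (forall y, exists x, p x = y) -> ghom 0 f ->
  exists2 g : P -> M, ghom 0 g & forall x, p (g x) = f x.

Record gresolution (M : gmod) : Type := GResolution {
  res_obj :> nat -> gmod;
  res_proj : forall i, gprojective (res_obj i);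
  res_diff : forall i, res_obj i.+1 -> res_obj i;
  res_aug : res_obj 0 -> M;
  res_diff_hom : forall i, ghom 0 (@res_diff i);
  res_aug_hom : ghom 0 res_aug;
  res_aug_surj : forall y, exists x, res_aug x = y;
  res_exact0 : forall x, res_aug x = 0 <-> exists y, res_diff y = x;
  res_exact : forall i (x : res_obj i.+1),
    res_diff x = 0 <-> exists y, res_diff y = x
}.

(* Cocycles and coboundaries of the complex Hom^j(P_i, N), i >= 0. *)
Definition ext_cocycle (M N : gmod) (P : gresolution M) (i : nat) (j : int) :
    set (P i -> N) :=
  [set f | ghom j f /\ forall x, f (res_diff x) = 0].

Definition ext_coboundary (M N : gmod) (P : gresolution M) (i : nat) (j : int) :
    set (P i -> N) :=
  match i with
  | 0%N => [set f | forall x, f x = 0]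
  | i'.+1 => [set f | exists2 g : P i' -> N, ghom j g &
                       forall x, f x = g (res_diff x)]
  end.

Arguments ext_cocycle {M} N P i j.
Arguments ext_coboundary {M} N P i j.

(* Ext^{i,j}(M, N) = 0, Ext being computed by projective resolutions of M. *)
Definition ext_eq0 (M N : gmod) (i : nat) (j : int) : Prop :=
  forall P : gresolution M, ext_cocycle N P i j `<=` ext_coboundary N P i j.

(* The trivial module F, in degree 0: U(L) acts through its augmentation. *)
Definition trivial_sort : Type := F.
HB.instance Definition _ := GRing.Zmodule.on trivial_sort.

Definition trivial_scale (u : envelope L) (x : trivial_sort) : trivial_sort :=
  augmentation u * x.
Fact trivial_scaleA u v x :
  trivial_scale u (trivial_scale v x) = trivial_scale (u * v) x.
Proof. by rewrite /trivial_scale augmentationM mulrA. Qed.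
Fact trivial_scale1 : left_id 1 trivial_scale.
Proof. by move=> x; rewrite /trivial_scale augmentation1 mul1r. Qed.
Fact trivial_scaleDr : right_distributive trivial_scale +%R.
Proof. by move=> u x y; rewrite /trivial_scale mulrDr. Qed.
Fact trivial_scaleDl x : {morph trivial_scale^~ x : u v / u + v}.
Proof. by move=> u v; rewrite /trivial_scale augmentationD mulrDl. Qed.
HB.instance Definition _ := GRing.Zmodule_isLmodule.Build (envelope L)
  trivial_sort trivial_scaleA trivial_scale1 trivial_scaleDr trivial_scaleDl.

Definition trivial_comp (k : int) : set trivial_sort :=
  [set x | k = 0 \/ x = 0].

Fact trivial_grading : is_grading trivial_comp.
Proof.
split=> [k|k x y [->|->]|x|s f us fC sum0 i si].
- by right.
- by left.
- by case=> [->|->]; [left | right; rewrite subr0].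
- exists [:: 0], (fun k => if k == 0 then x else 0).
    by move=> k; case: eqP; [left | right].
  by rewrite big_seq1.
- have [i0|//] := fC i; move: sum0; rewrite (bigD1_seq i) //= big1 ?addr0 //.
  by move=> k /eqP ki; case: (fC k) => // k0; case: ki; rewrite k0.
Qed.

Fact augmentation_ucomp n u : ucomp n u -> n = 0%N \/ augmentation u = 0.
Proof.
have aug0 : augmentation (0 : envelope L) = 0.
  by apply: (addrI (augmentation (0 : envelope L))); rewrite -augmentationD !addr0.
elim=> {n u} [n|n a u v _ IHu _ IHv||n x _|n m u v _ IHu _ IHv].
- by right.
- case: IHu => [|u0]; first by left.
  case: IHv => [|v0]; first by left.
  right; rewrite augmentationD v0 addr0 -[u]mul1r scalerAl.
  by rewrite augmentationM u0 mulr0.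
- by left.
- by right; rewrite augmentation_upi.
- case: IHu => [->|u0]; last by right; rewrite augmentationM u0 mul0r.
  by case: IHv => [->|v0]; [left | right; rewrite augmentationM v0 mulr0].
Qed.

Fact trivial_act n k (u : envelope L) (x : trivial_sort) :
  ucomp n u -> trivial_comp k x -> trivial_comp (n%:Z + k) (u *: x).
Proof.
move=> /augmentation_ucomp[->|u0]; last first.
  by move=> _; right; rewrite -[LHS]/(augmentation u * x) u0 mul0r.
by rewrite add0r => -[k0|->]; [left | right; rewrite scaler0].
Qed.

Definition trivial_gmod : gmod := GMod trivial_grading trivial_act.

Definition koszul : Prop :=
  forall (i : nat) (j : int), i%:Z != j -> ext_eq0 trivial_gmod trivial_gmod i j.

End Cohomology.

Section BlochKato.
Variable F : fieldType.

Definition one_generated (L : gradedLieType F) : Prop :=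
  forall x : L, lie_span (hcomp 1) x.

(* The 1-generated subalgebras of L are the gen1 S, S a set of elements of
   degree 1. *)
Definition bloch_kato (L : gradedLieType F) : Prop :=
  one_generated L /\
  forall S : set L, S `<=` hcomp 1 -> koszul (sub_algebra (gen1 S)).

(* L, with the homomorphisms iA and iB, is the coproduct of A and B in the
   category of N-graded Lie algebras. *)
Definition is_free_product (A B L : gradedLieType F)
    (iA : A -> L) (iB : B -> L) : Prop :=
  [/\ graded_lie_hom iA, graded_lie_hom iB &
   forall (M : gradedLieType F) (f : A -> M) (g : B -> M),
     graded_lie_hom f -> graded_lie_hom g ->
   exists! h : L -> M,
     [/\ graded_lie_hom h, forall x, h (iA x) = f x &
         forall y, h (iB y) = g y]].

Definition is_free_product3 (A B C L : gradedLieType F)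
    (iA : A -> L) (iB : B -> L) (iC : C -> L) : Prop :=
  [/\ graded_lie_hom iA, graded_lie_hom iB, graded_lie_hom iC &
   forall (M : gradedLieType F) (f : A -> M) (g : B -> M) (k : C -> M),
     graded_lie_hom f -> graded_lie_hom g -> graded_lie_hom k ->
   exists! h : L -> M,
     [/\ graded_lie_hom h, forall x, h (iA x) = f x,
         forall y, h (iB y) = g y & forall z, h (iC z) = k z]].

(* The inclusion K -> H of graded subalgebras of L. *)
Definition sub_incl (L : gradedLieType F) (K H : gradedSub L)
    (sKH : K `<=` H) (x : sub_algebra K) : sub_algebra H :=
  SubElt (mem_set (sKH _ (set_mem (valP x)))).

(* H = K1 \amalg K2 \amalg K3 for graded subalgebras of L. *)
Definition internal_free_product3 (L : gradedLieType F)
    (H K1 K2 K3 : gradedSub L) : Prop :=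
  exists (s1 : K1 `<=` H) (s2 : K2 `<=` H) (s3 : K3 `<=` H),
    is_free_product3 (sub_incl s1) (sub_incl s2) (sub_incl s3).

(* L is the free Lie algebra on its subspace W: every linear map from W to a
   Lie algebra M extends to a unique homomorphism L -> M.  The map is given by
   any f : L -> M that is linear on W. *)
Definition free_on (L : lieType F) (W : set L) : Prop :=
  subspace W /\
  forall (M : lieType F) (f : L -> M),
    (forall (a : F) x y, W x -> W y -> f (a *: x + y) = a *: f x + f y) ->
  exists! g : L -> M, lie_hom g /\ forall x, W x -> g x = f x.

(* V is the internal direct sum of its subspaces W1, W2, W3. *)
Definition direct_sum3 (V0 : lmodType F) (V W1 W2 W3 : set V0) : Prop :=
  (forall x, V x <->
    exists x1 x2 x3, [/\ W1 x1, W2 x2, W3 x3 & x = x1 + x2 + x3]) /\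
  (forall x1 x2 x3, W1 x1 -> W2 x2 -> W3 x3 -> x1 + x2 + x3 = 0 ->
    [/\ x1 = 0, x2 = 0 & x3 = 0]).

End BlochKato.

(* Main.v *)
Require Import Defs.
From HB Require Import structures.
From mathcomp Require Import all_boot all_algebra.
From mathcomp Require Import boolp classical_sets functions.

Set Implicit Arguments.
Unset Strict Implicit.
Unset Printing Implicit Defensive.

Import GRing.Theory.

Local Open Scope classical_set_scope.
Local Open Scope ring_scope.

(* The universal property of H is checked on representations.  Let M be a graded
   Lie algebra, with prescribed maps from W, <H1 /\ A> and <H1 /\ B> to M, and let
   Z be a nilpotent representation of M.  By a Poincare-Birkhoff-Witt argument
   (coinduction along codimension-one ideals) the resulting action of <H1 /\ A>
   on Z is covered by an A-module I_A -> Z in such a way that, for a basis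
   w_k = a_k + b_k of W, the images in Z of v and of all the a_k v can be prescribed
   independently for v in I_A; similarly for B.  On Q = I_A x I_B let A act through
   I_A, and let B act through I_B conjugated by an automorphism that turns the
   coordinates (z, a_k v = y_k) into (z, b_k v = w_k z - y_k).  Then Q is an
   L-module, and Q -> I_A -> Z carries the action of x in H1 to the action of its
   prescribed image in M.  As M has enough nilpotent representations, this defines
   the homomorphism H -> M. *)

(** * Subspaces and independent families *)

(** [L] is known only through its universal property, so its elements have no normal form at hand.
    What must be proved is that a relation holding in [L] between elements of H1 also holds between
    their prescribed images in M. A surjection from an L-module Q onto Z, intertwining the actions
    of the generators, carries the relation over to Z; the nilpotent Z then separate the points of
    M, provided M has finite-dimensional components. This is achieved by replacing M by the
    subalgebra generated by the images of bases of W, H1 /\ A and H1 /\ B. The values on the a_k v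
    can be prescribed because the a_k are independent modulo H1 /\ A: if a combination w = a + b of
    the w_k has a in H1 /\ A, then b = w - a is in H1 /\ B, and directness forces w = 0. Nilpotency
    is what supplies the chain of codimension-one steps: it refines the filtration by degree, whose
    layers are finite-dimensional since A and B are generated by finite-dimensional spaces in degree
    1. Finally End(Q) carries no grading, whereas the universal property of [L] concerns graded
    algebras; homomorphisms to End(Q) are therefore factored through t End(Q)[t]. *)

Definition linear_on (F : fieldType) (V V' : lmodType F) (U : set V) (f : V -> V') :=
  forall (a : F) x y, U x -> U y -> f (a *: x + y) = a *: f x + f y.

Section Subspaces.
Variables (F : fieldType) (V : lmodType F).
Implicit Types (U W : set V) (e : seq V).

Lemma subspaceD U x y : subspace U -> U x -> U y -> U (x + y).
Proof. by case=> _ Ul Ux Uy; rewrite -[x]scale1r; apply: Ul. Qed.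

Lemma subspaceZ U a x : subspace U -> U x -> U (a *: x).
Proof. by case=> U0 Ul Ux; rewrite -[_ *: x]addr0; apply: Ul. Qed.

Lemma subspaceN U x : subspace U -> U x -> U (- x).
Proof. by move=> sU Ux; rewrite -scaleN1r; apply: subspaceZ. Qed.

Lemma subspaceB U x y : subspace U -> U x -> U y -> U (x - y).
Proof. by move=> sU Ux Uy; apply: subspaceD => //; apply: subspaceN. Qed.

Lemma subspace_sum U (I : Type) (s : seq I) (P : pred I) (f : I -> V) :
  subspace U -> (forall i, P i -> U (f i)) -> U (\sum_(i <- s | P i) f i).
Proof.
move=> sU fU; elim/big_ind: _ => //; first by case: sU.
by move=> x y; apply: subspaceD.
Qed.

Section LinearOn.
Variables (V' : lmodType F) (U : set V) (f : V -> V').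
Hypotheses (sU : subspace U) (fl : linear_on U f).

Lemma linear_on0 : f 0 = 0.
Proof.
have U0 : U 0 by case: sU.
by have := fl (-1) U0 U0; rewrite scaler0 addr0 scaleN1r addNr.
Qed.
Lemma linear_onD x y : U x -> U y -> f (x + y) = f x + f y.
Proof. by move=> Ux Uy; have := fl 1 Ux Uy; rewrite !scale1r. Qed.
Lemma linear_onZ a x : U x -> f (a *: x) = a *: f x.
Proof.
have U0 : U 0 by case: sU.
by move=> Ux; have := fl a Ux U0; rewrite !addr0 linear_on0 addr0.
Qed.
Lemma linear_onN x : U x -> f (- x) = - f x.
Proof. by move=> Ux; rewrite -scaleN1r linear_onZ // scaleN1r. Qed.
Lemma linear_onB x y : U x -> U y -> f (x - y) = f x - f y.
Proof.
move=> Ux Uy; rewrite linear_onD //; first by rewrite linear_onN.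
exact: subspaceN.
Qed.
Lemma linear_on_sum (I : Type) (s : seq I) (P : pred I) (g : I -> V) :
  (forall i, P i -> U (g i)) ->
  f (\sum_(i <- s | P i) g i) = \sum_(i <- s | P i) f (g i).
Proof.
move=> gU; suff: U (\sum_(i <- s | P i) g i) /\
  f (\sum_(i <- s | P i) g i) = \sum_(i <- s | P i) f (g i) by case.
elim/big_rec2: _ => [|i x y Pi [Ux <-]]; first by split; [case: sU | exact: linear_on0].
split; first by apply: subspaceD => //; apply: gU.
by rewrite linear_onD //; apply: gU.
Qed.
End LinearOn.

Definition add_line U x : set V := [set y | exists2 c, U (y - c *: x) & True].

Lemma add_lineP U x y : add_line U x y <-> exists u c, U u /\ y = u + c *: x.
Proof.
split=> [[c Uu _]|[u [c [Uu ->]]]]; last by exists c; rewrite ?addrK.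
by exists (y - c *: x), c; rewrite subrK.
Qed.

Lemma sub_add_line U x : U `<=` add_line U x.
Proof. by move=> y Uy; exists 0; rewrite // scale0r subr0. Qed.

Lemma mem_add_line U x : subspace U -> add_line U x x.
Proof. by case=> U0 _; exists 1; rewrite // scale1r subrr. Qed.

Lemma add_line_subspace U x : subspace U -> subspace (add_line U x).
Proof.
move=> sU; split; first by apply: sub_add_line; case: sU.
move=> a y z [c Uy _] [d Uz _]; exists (a * c + d) => //.
rewrite scalerDl -scalerA opprD addrACA -scalerBr.
by apply: subspaceD => //; apply: subspaceZ.
Qed.

Lemma add_line_min U W x : subspace W -> U `<=` W -> W x -> add_line U x `<=` W.
Proof.
move=> sW UW Wx y [c Uy _]; rewrite -[y](subrK (c *: x)).
by apply: subspaceD => //; [apply: UW | apply: subspaceZ].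
Qed.

Lemma add_line_coef_inj U x c d y : subspace U -> ~ U x ->
  U (y - c *: x) -> U (y - d *: x) -> c = d.
Proof.
move=> sU Ux Uc Ud; apply/eqP; apply: contrapT => /negP cd; apply: Ux.
have := subspaceB sU Ud Uc; rewrite opprB addrC addrA subrK -scalerBl => Uz.
rewrite -[x]scale1r -(mulVf (x := c - d)) ?subr_eq0 // -scalerA.
exact: subspaceZ.
Qed.

Fixpoint add_span U e : set V :=
  if e is x :: e' then add_span (add_line U x) e' else U.

Lemma sub_add_span U e : U `<=` add_span U e.
Proof.
elim: e U => [|x e IHe] U //=.
by apply: subset_trans (@IHe _); apply: sub_add_line.
Qed.

Lemma add_span_subspace U e : subspace U -> subspace (add_span U e).
Proof. by elim: e U => [|x e IHe] U //= sU; apply/IHe/add_line_subspace. Qed.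

Lemma mem_add_span U e x : subspace U -> x \in e -> add_span U e x.
Proof.
elim: e U => [|y e IHe] U //= sU; rewrite inE => /predU1P[->|xe].
  by apply: sub_add_span; apply: mem_add_line.
by apply: IHe => //; apply: add_line_subspace.
Qed.

Lemma add_span_min U W e : subspace W -> U `<=` W ->
  (forall x, x \in e -> W x) -> add_span U e `<=` W.
Proof.
move=> sW; elim: e U => [|y e IHe] U //= UW eW; apply: IHe.
  by apply: add_line_min => //; apply: eW; rewrite mem_head.
by move=> x xe; apply: eW; rewrite inE xe orbT.
Qed.

Lemma add_span_cat U e1 e2 : add_span U (e1 ++ e2) = add_span (add_span U e1) e2.
Proof. by elim: e1 U => [|x e IHe] U /=. Qed.

(* The classes modulo U of the members of e are linearly independent. *)
Fixpoint free_mod U e : Prop :=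
  if e is x :: e' then ~ U x /\ free_mod (add_line U x) e' else True.

Lemma free_mod_cat U e1 e2 :
  free_mod U (e1 ++ e2) <-> free_mod U e1 /\ free_mod (add_span U e1) e2.
Proof.
elim: e1 U => [|x e IHe] U /=; first by split=> [|[]].
split=> [[Ux /IHe[]]|[[Ux fe] fe2]]; first by [].
by split=> //; apply/IHe.
Qed.

(** Steinitz exchange along the list. If [W] is already inside the span of the tail, the head v is
    dropped. Otherwise some x in [W] involves v with a nonzero coefficient, and x takes the place of
    v. The basis obtained lies in [W], which [e] need not do. *)
Lemma exists_free_mod U W e : subspace U -> subspace W -> U `<=` W ->
    W `<=` add_span U e ->
  exists2 e', free_mod U e' /\ (forall x, x \in e' -> W x) & add_span U e' = W.
Proof.
move=> + sW; elim: e U => [|v e IHe] U /= sU UW We.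
  by exists [::] => //; apply/seteqP.
have [[x [Wx Ux]]|WU] := pselect (exists x, W x /\ ~ add_span U e x); last first.
  by apply: IHe => // x Wx; apply: contrapT => Ux; apply: WU; exists x.
have Uxx : ~ U x by move=> /(@sub_add_span _ e).
have swap : forall e' W', subspace W' -> add_span (add_line W' v) e' `<=`
    add_line (add_span W' e') v.
  move=> e' W' sW'; apply: add_span_min.
  - exact/add_line_subspace/add_span_subspace.
  - apply: add_line_min.
    + exact/add_line_subspace/add_span_subspace.
    + apply: subset_trans (@sub_add_line _ _).
      exact: sub_add_span.
    + exact/mem_add_line/add_span_subspace.
  - move=> y ye; apply: sub_add_line; exact: mem_add_span.
have [|||e' [fe' We'] eW] := IHe (add_line U x).
- exact: add_line_subspace.
- exact: add_line_min.
- have sUx := add_span_subspace e (add_line_subspace x sU).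
  have Uv : add_span (add_line U x) e v.
    have [c Uxv _] := swap _ _ sU _ (We _ Wx).
    have c0 : c != 0.
      by apply/eqP=> c0; apply: Ux; move: Uxv; rewrite c0 scale0r subr0.
    rewrite -[v]scale1r -(mulVf c0) -scalerA; apply: subspaceZ => //.
    rewrite -[c *: v](subKr x); apply: subspaceB => //.
      by apply: sub_add_span; apply: mem_add_line.
    apply: (@add_span_min U _ e) Uxv => //.
      by apply: subset_trans (@sub_add_span _ _); apply: sub_add_line.
    by move=> y ye; apply: mem_add_span => //; apply: add_line_subspace.
  apply: subset_trans We _; apply: add_span_min => //.
    apply: add_line_min => //.
    by apply: subset_trans (@sub_add_span _ _); apply: sub_add_line.
  by move=> y ye; apply: mem_add_span => //; apply: add_line_subspace.
exists (x :: e') => //; split=> //.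
by move=> y; rewrite inE => /predU1P[->|/We'].
Qed.

Lemma linear_on_add_span (V' : lmodType F) (f : V -> V') (U : set V)
    (U' : set V') e :
    subspace U -> subspace U' ->
    linear_on (add_span U e) f ->
    (forall x, U x -> U' (f x)) -> (forall x, x \in e -> U' (f x)) ->
  forall x, add_span U e x -> U' (f x).
Proof.
move=> sU sU' fl fU fe.
have sS := add_span_subspace e sU.
suff S : add_span U e `<=` [set x | add_span U e x /\ U' (f x)].
  by move=> x /S[].
apply: add_span_min => [||x xe].
- split; first by split; [case: sS | rewrite (linear_on0 sS fl); case: sU'].
  move=> a x y [Sx Ux] [Sy Uy]; split; first by case: sS => _; apply.
  by rewrite fl //; case: sU' => _; apply.
- by move=> x Ux; split; [apply: sub_add_span | apply: fU].
- by split; [apply: mem_add_span | apply: fe].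
Qed.

End Subspaces.

Lemma subspace0 (F : fieldType) (V : lmodType F) : subspace [set (0 : V)].
Proof. by split=> // a x y -> ->; rewrite scaler0 addr0. Qed.

Lemma subspaceT (F : fieldType) (V : lmodType F) : subspace [set: V].
Proof. by split. Qed.

(** * Coinduced representations *)

Section LieBracket.
Variables (F : fieldType) (L : lieType F).
Implicit Types x y z : L.

Lemma lie0l x : lie 0 x = 0.
Proof. by have := lie_linearl x (-1) 0 0; rewrite scaler0 addr0 scaleN1r addNr. Qed.
Lemma lie0r x : lie x 0 = 0.
Proof. by have := lie_linearr x (-1) 0 0; rewrite scaler0 addr0 scaleN1r addNr. Qed.
Lemma lieDl x y z : lie (x + y) z = lie x z + lie y z.
Proof. by have := lie_linearl z 1 x y; rewrite !scale1r. Qed.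
Lemma lieDr x y z : lie z (x + y) = lie z x + lie z y.
Proof. by have := lie_linearr z 1 x y; rewrite !scale1r. Qed.
Lemma lieZl a x y : lie (a *: x) y = a *: lie x y.
Proof. by have := lie_linearl y a x 0; rewrite lie0l !addr0. Qed.
Lemma lieZr a x y : lie y (a *: x) = a *: lie y x.
Proof. by have := lie_linearr y a x 0; rewrite lie0r !addr0. Qed.
Lemma lieNr x y : lie y (- x) = - lie y x.
Proof. by rewrite -scaleN1r lieZr scaleN1r. Qed.
Lemma lie_suml (I : Type) (s : seq I) (P : pred I) (f : I -> L) y :
  lie (\sum_(i <- s | P i) f i) y = \sum_(i <- s | P i) lie (f i) y.
Proof. by elim/big_rec2: _ => [|i u v _ <-]; rewrite ?lie0l ?lieDl. Qed.
Lemma lie_sumr (I : Type) (s : seq I) (P : pred I) (f : I -> L) y :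
  lie y (\sum_(i <- s | P i) f i) = \sum_(i <- s | P i) lie y (f i).
Proof. by elim/big_rec2: _ => [|i u v _ <-]; rewrite ?lie0r ?lieDr. Qed.
Lemma lieC x y : lie x y = - lie y x.
Proof.
apply/eqP; rewrite -addr_eq0; apply/eqP.
by have := liexx (x + y); rewrite lieDl !lieDr !liexx addr0 add0r.
Qed.
Lemma lie_derivation x y z : lie x (lie y z) = lie (lie x y) z + lie y (lie x z).
Proof.
have := lie_jacobi x y z; rewrite -addrA => /eqP; rewrite addr_eq0 => /eqP->.
by rewrite opprD addrC (lieC z) (lieC z x) lieNr !opprK.
Qed.
End LieBracket.

Definition lie_closed (F : fieldType) (L : lieType F) (U : set L) : Prop :=
  forall x y, U x -> U y -> U (lie x y).

(** [rho] is total on [A] but constrained only on [U], so that a representation can be extended to a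
    larger subalgebra without any change of type. *)
Definition is_rep (F : fieldType) (A : lieType F) (U : set A) (Z : lmodType F)
    (rho : A -> Z -> Z) : Prop :=
  [/\ forall x, U x -> linear (rho x),
      forall z, linear_on U (rho^~ z) &
      forall x y z, U x -> U y ->
        rho (lie x y) z = rho x (rho y z) - rho y (rho x z)].

Section Coinduced.
Variables (F : fieldType) (A : lieType F) (U : set A) (x : A).
Hypotheses (sU : subspace U) (lU : lie_closed U).
Hypotheses (Ux : ~ U x) (xU : forall u, U u -> U (lie x u)).
Variables (Z : lmodType F) (rho : A -> Z -> Z).
Hypothesis repU : is_rep U rho.
Implicit Types phi : nat -> Z.

Definition shift phi : nat -> Z := fun n => phi n.+1.

(* [phi n] stands for the value at x^n of a U(A)-linear map into Z, so that
   [coind_act u phi n] is its value at x^n u, computed from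
   x^(n+1) u = x^n u x + x^n [x, u]. *)
Fixpoint coind_at (n : nat) (u : A) phi : Z :=
  if n is m.+1 then coind_at m u (shift phi) + coind_at m (lie x u) phi
  else rho u (phi 0%N).
Definition coind_act u phi : nat -> Z := fun n => coind_at n u phi.

Lemma shiftP a phi psi : shift (a *: phi + psi) = a *: shift phi + shift psi.
Proof. by []. Qed.

Lemma coind_actP u a phi psi : U u ->
  coind_act u (a *: phi + psi) = a *: coind_act u phi + coind_act u psi.
Proof.
have [rl _ _] := repU.
move=> Uu; apply/funext => n.
change (coind_at n u (a *: phi + psi) = a *: coind_at n u phi + coind_at n u psi).
elim: n u Uu phi psi => [|n IHn] u Uu phi psi /=; first exact: rl.
by rewrite shiftP !IHn ?scalerDr 1?addrACA //; apply: xU.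
Qed.

Lemma coind_act_linear_on phi : linear_on U (coind_act^~ phi).
Proof.
have [_ rl _] := repU.
move=> a u v Uu Uv; apply/funext => n.
change (coind_at n (a *: u + v) phi = a *: coind_at n u phi + coind_at n v phi).
elim: n u v Uu Uv phi => [|n IHn] u v Uu Uv phi /=; first exact: rl.
by rewrite lie_linearr !IHn ?scalerDr 1?addrACA //; apply: xU.
Qed.

Lemma shift_coind_act u phi :
  shift (coind_act u phi) = coind_act u (shift phi) + coind_act (lie x u) phi.
Proof. by []. Qed.

(** Both [shift] (by [shift_coind_act]) and the bracket with [x] obey the Leibniz rule. Hence the
    identity at n + 1 follows from the identity at n for the pairs (u, v), ([x, u], v) and (u,
    [x, v]). *)
Lemma coind_act_lie u v phi : U u -> U v ->
  coind_act (lie u v) phi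
  = coind_act u (coind_act v phi) - coind_act v (coind_act u phi).
Proof.
have [_ _ rb] := repU.
move=> Uu Uv; apply/funext => n.
change (coind_at n (lie u v) phi
  = coind_at n u (coind_act v phi) - coind_at n v (coind_act u phi)).
elim: n u v Uu Uv phi => [|n IHn] u v Uu Uv phi /=; first exact: rb.
have atD w f g : U w -> coind_at n w (f + g) = coind_at n w f + coind_at n w g.
  move=> Uw; have := coind_actP 1 f g Uw; rewrite !scale1r.
  by move/(congr1 (fun h : nat -> Z => h n)).
have lieU w : U w -> U (lie x w) by apply: xU.
have xuv : coind_at n (lie x (lie u v)) phi
   = coind_at n (lie (lie x u) v) phi + coind_at n (lie u (lie x v)) phi.
  rewrite lie_derivation.
  have := coind_act_linear_on phi 1 (lU (lieU _ Uu) Uv) (lU Uu (lieU _ Uv)).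
  by rewrite !scale1r => /(congr1 (fun h : nat -> Z => h n)).
rewrite xuv (IHn u v) // (IHn (lie x u) v) ?(IHn u (lie x v)); try by auto.
rewrite !shift_coind_act !atD //.
by rewrite !opprD !addrA [LHS](ACl (1*5*3*2*4*6)).
Qed.

(** The coordinate of y along [x], unique because [x] is not in [U]; the default 0 is taken only
    outside [add_line U x]. *)
Definition line_coef (y : A) : F := xget 0 [set c | U (y - c *: x)].
Definition coind_rep (y : A) phi : nat -> Z :=
  coind_act (y - line_coef y *: x) phi + line_coef y *: shift phi.

Lemma coind_repE u c phi : U u ->
  coind_rep (u + c *: x) phi = coind_act u phi + c *: shift phi.
Proof.
move=> Uu; rewrite /coind_rep.
have -> : line_coef (u + c *: x) = c; last by rewrite addrK.
rewrite /line_coef; case: xgetP => [d _ /= Ud|/(_ c)]; last by rewrite /= addrK.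
by apply: (add_line_coef_inj sU Ux Ud); rewrite addrK.
Qed.

Lemma coind_rep_act u phi : U u -> coind_rep u phi = coind_act u phi.
Proof.
by move=> Uu; have := coind_repE 0 phi Uu; rewrite !scale0r !addr0.
Qed.

Lemma coind_rep_line phi : coind_rep x phi = shift phi.
Proof.
have U0 : U 0 by case: sU.
have := coind_repE 1 phi U0; rewrite !scale1r add0r => ->.
have -> : coind_act 0 phi = 0; last by rewrite add0r.
exact: (linear_on0 sU (coind_act_linear_on phi)).
Qed.

Lemma add_line_lie_closed : lie_closed (add_line U x).
Proof.
move=> _ _ /add_lineP[u [c [Uu ->]]] /add_lineP[v [d [Uv ->]]].
apply: sub_add_line; rewrite lieDl !lieDr !lieZl !lieZr liexx !scaler0 addr0.
rewrite (lieC u x) scalerN -scaleNr.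
apply: subspaceD => //; last by apply: subspaceZ => //; apply: xU.
apply: subspaceD => //; first exact: lU.
by apply: subspaceZ => //; apply: xU.
Qed.

(** [x] acts as [shift], and [shift_coind_act] says exactly that [x, u] acts as the commutator of
    [x] and u. The rest is bilinearity and [coind_act_lie]. *)
Lemma coind_is_rep : is_rep (add_line U x) coind_rep.
Proof.
have actD u f g : U u -> coind_act u (f + g) = coind_act u f + coind_act u g.
  by move=> Uu; have := coind_actP 1 f g Uu; rewrite !scale1r.
have actZ u a f : U u -> coind_act u (a *: f) = a *: coind_act u f.
  move=> Uu; have act0 : coind_act u 0 = 0.
    by have := actD u 0 0 Uu; rewrite addr0 -[LHS]addr0 => /addrI.
  by have := coind_actP a f 0 Uu; rewrite !addr0 act0 addr0.
split.
- move=> _ /add_lineP[u [c [Uu ->]]] a phi psi.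
  rewrite !coind_repE // coind_actP // shiftP !scalerDr !scalerA.
  by rewrite [a * c]mulrC addrACA.
- move=> phi a _ _ /add_lineP[u [c [Uu ->]]] /add_lineP[v [d [Uv ->]]].
  rewrite scalerDr addrACA scalerA -scalerDl.
  have [_ Ul] := sU; rewrite !coind_repE //; last exact: Ul.
  rewrite coind_act_linear_on // scalerDr scalerA scalerDl.
  by rewrite addrACA.
- move=> _ _ phi /add_lineP[u [c [Uu ->]]] /add_lineP[v [d [Uv ->]]].
  rewrite lieDl !lieDr !lieZl !lieZr liexx !scaler0 addr0.
  rewrite (lieC u x) scalerN -scaleNr.
  have Uxu := xU Uu; have Uxv := xU Uv; have Uuv := lU Uu Uv.
  have actl := coind_act_linear_on phi.
  have UZ a w : U w -> U (a *: w) by apply: subspaceZ.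
  have UD w w' : U w -> U w' -> U (w + w') by apply: subspaceD.
  rewrite coind_rep_act; last by auto.
  rewrite !(linear_onD actl) ?(linear_onZ sU actl); try by auto.
  rewrite coind_act_lie // !coind_repE // !actD // !actZ //.
  have shD f g : shift (f + g) = shift f + shift g by [].
  have shZ a f : shift (a *: f) = a *: shift f by [].
  rewrite !shD !shZ !shift_coind_act !scalerDr !scalerA.
  rewrite [d * c]mulrC scaleNr !opprD !addrA.
  by rewrite [RHS](ACl (1*6*9*4*(2*8)*(3*7)*(5*10))) /= !subrr !addr0.
Qed.

End Coinduced.

(* [extends_rep A0 rho0 J U d]: U has a representation I killed by J, with an
   A0-equivariant map pi onto the representation rho0 of A0 on Z, such that the
   values of pi on v and on the d_k v, for v in I, can be prescribed linearly
   (by the section s) and independently. *)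
Definition extends_rep (F : fieldType) (A : lieType F) (A0 : set A)
    (Z : lmodType F) (rho0 : A -> Z -> Z) (J U : set A) (d : seq A) : Prop :=
  exists (I : lmodType F) (rho : A -> I -> I) (pi : I -> Z)
         (s : Z -> (nat -> Z) -> I),
  [/\ is_rep U rho,
      forall x v, J x -> rho x v = 0,
      linear pi /\ (forall x v, A0 x -> pi (rho x v) = rho0 x (pi v)),
      forall a z z' y y',
        s (a *: z + z') (a *: y + y') = a *: s z y + s z' y' &
      forall z y, pi (s z y) = z /\
        forall k, (k < size d)%N -> pi (rho d`_k (s z y)) = y k].

(** * Extension of representations by one direction at a time *)

Section ExtendsRep.
Variables (F : fieldType) (A : lieType F) (A0 : set A).
Variables (Z : lmodType F) (rho0 : A -> Z -> Z) (J : set A).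
Hypothesis lieJ : forall x y, J y -> J (lie x y).
Implicit Types (U V : set A) (d e : seq A).

Lemma extends_rep_catl U d e :
  extends_rep A0 rho0 J U (d ++ e) -> extends_rep A0 rho0 J U d.
Proof.
move=> [I [rho [pi [s [rI JI piI sl sP]]]]]; exists I, rho, pi, s; split=> //.
move=> z y; have [pis rhos] := sP z y; split=> // k kd.
rewrite -rhos; first by rewrite nth_cat kd.
by rewrite size_cat ltn_addr.
Qed.

(** In the coinduced module the new projection reads phi 0 and [x] is the shift, so the projection
    of [x] phi reads phi 1, which is independent of phi 0. Thus phi 0 is chosen by the old section
    for the old directions, and phi 1 so as to project to the value wanted for [x], whose index is
    [size d]. Elements of [J] still act as 0 because [J] is stable under the bracket with [x]. *)
Lemma extends_rep_line U d x : subspace U -> lie_closed U ->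
    A0 `<=` U -> J `<=` U -> (forall y, y \in d -> U y) ->
    ~ U x -> (forall u, U u -> U (lie x u)) ->
  extends_rep A0 rho0 J U d -> extends_rep A0 rho0 J (add_line U x) (rcons d x).
Proof.
move=> sU lU A0U JU dU Ux xU [I [rho [pi [s [rI JI [pil piI] sl sP]]]]].
exists (nat -> I), (coind_rep U x rho), (fun phi => pi (phi 0%N)).
exists (fun z y n => match n with 0 => s z y | 1 => s (y (size d)) 0 | _ => 0 end).
split.
- exact: coind_is_rep.
- move=> u v Ju; rewrite coind_rep_act //; last exact: JU.
  apply/funext => n; change (coind_at x rho n u v = 0).
  elim: n u Ju v => [|n IHn] u Ju v /=; first exact: JI.
  by rewrite !IHn ?addr0 //; apply: lieJ.
- split=> [a v w|u v A0u]; first exact: pil.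
  rewrite coind_rep_act //; last exact: A0U.
  exact: piI.
- move=> a z z' y y'; apply/funext => -[|[|n]] //=.
  + have := sl a (y (size d)) (y' (size d)) 0 0.
    by rewrite scaler0 addr0.
  + by rewrite -[LHS](addr0 (0 : I)) -[X in X + _](scaler0 _ a).
- move=> z y; have [pis rhos] := sP z y; split=> // k.
  rewrite size_rcons nth_rcons ltnS leq_eqVlt => /predU1P[->|kd].
    rewrite ltnn eqxx coind_rep_line // /shift /=.
    by have [] := sP (y (size d)) 0.
  rewrite kd coind_rep_act //; last exact/dU/mem_nth.
  exact: rhos.
Qed.

(** As [V, V] lies in [U], every subspace between [U] and [V] is an ideal of [V]; the members of [e]
    can therefore be adjoined one after the other, each step being a codimension-one extension. *)
Lemma extends_rep_span U V d e : subspace U -> subspace V -> lie_closed U ->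
    (forall x u, V x -> V u -> U (lie x u)) -> U `<=` V ->
    A0 `<=` U -> J `<=` U -> (forall y, y \in d -> U y) ->
    free_mod U e -> (forall x, x \in e -> V x) ->
  extends_rep A0 rho0 J U d -> extends_rep A0 rho0 J (add_span U e) (d ++ e).
Proof.
move=> sU sV + + + A0U JU; elim: e U sU A0U JU d => [|x e IHe] U sU A0U JU d.
  by rewrite cats0.
move=> lU VU UV dU /= [Ux fe] xeV ext; rewrite -cat_rcons.
have Vx : V x by apply: xeV; rewrite mem_head.
have UUx := @sub_add_line _ _ U x.
apply: IHe => //.
- exact: add_line_subspace.
- exact: subset_trans UUx.
- exact: subset_trans UUx.
- by apply: add_line_lie_closed => // u Uu; apply: VU => //; apply: UV.
- by move=> y u Vy Vu; apply/UUx/VU.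
- exact: add_line_min.
- move=> y; rewrite mem_rcons inE => /predU1P[->|yd]; first exact: mem_add_line.
  exact/UUx/dU.
- by move=> y ye; apply: xeV; rewrite inE ye orbT.
- by apply: extends_rep_line => // u Uu; apply: VU => //; apply: UV.
Qed.

Lemma extends_rep_abelian U V d0 d e :
    subspace U -> subspace V -> lie_closed U ->
    (forall x u, V x -> V u -> U (lie x u)) -> U `<=` V ->
    A0 `<=` U -> J `<=` U -> (forall x, x \in d0 -> U x) ->
    free_mod U d -> (forall x, x \in d -> V x) -> V `<=` add_span U e ->
  extends_rep A0 rho0 J U d0 -> extends_rep A0 rho0 J V (d0 ++ d).
Proof.
move=> sU sV lU VU UV A0U JU d0U fd dV Ve ext.
have sUd := add_span_subspace d sU.
have UdV := add_span_min sV UV dV.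
have [|e' [fe' e'V] VE] := @exists_free_mod _ _ _ V e sUd sV UdV.
  apply: subset_trans Ve _; apply: add_span_min.
  - exact: add_span_subspace.
  - by move=> x Ux; do 2!apply: sub_add_span.
  - by move=> x xe; apply: mem_add_span.
(* Complete d by a complement e', whose directions are then forgotten. *)
rewrite -VE -add_span_cat; apply: (@extends_rep_catl _ _ e'); rewrite -catA.
apply: (@extends_rep_span U V) => //; first exact/free_mod_cat.
by move=> x; rewrite mem_cat => /orP[/dV|/e'V].
Qed.

(* A0 + J acts on Z through A0, as J meets A0 in elements acting as 0. *)
Lemma extends_rep_ideal : subspace A0 -> lie_closed A0 -> subspace J ->
    is_rep A0 rho0 -> (forall x v, A0 x -> J x -> rho0 x v = 0) ->
  extends_rep A0 rho0 J [set x | exists2 a, A0 a & J (x - a)] [::].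
Proof.
move=> sA0 lA0 sJ [r1 r2 r3] A0J.
pose proj x := xget 0 [set a | A0 a /\ J (x - a)].
have projE x a v : A0 a -> J (x - a) -> rho0 (proj x) v = rho0 a v.
  move=> A0a Ja; rewrite /proj; case: xgetP => [b _ [A0b Jb]|/(_ a)[] //].
  apply/eqP; rewrite -subr_eq0 -(linear_onB sA0 (r2 v)) //; apply/eqP/A0J.
    exact: subspaceB.
  by have := subspaceB sJ Ja Jb; rewrite opprB addrC addrA subrK.
have projA a v : A0 a -> rho0 (proj a) v = rho0 a v.
  by move=> A0a; apply: projE => //; rewrite subrr; case: sJ.
exists Z, (fun x => rho0 (proj x)), id, (fun z _ => z); split=> //.
- split.
  + by move=> x [a A0a Ja] c v w; rewrite !(projE x a) //; apply: r1.
  + move=> v c x y [a A0a Ja] [b A0b Jb]; rewrite (projE x a) // (projE y b) //.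
    rewrite (projE _ (c *: a + b)) ?r2 //; first by case: sA0 => _; apply.
    by rewrite opprD addrACA -scalerBr; case: sJ => _; apply.
  + move=> x y v [a A0a Ja] [b A0b Jb].
    rewrite !(projE x a) // !(projE y b) // -r3 //; apply: projE; first exact: lA0.
    rewrite -[x](subrK a) lieDl -addrA -[X in lie a X](subrK b) lieDr addrK.
    by apply: subspaceD => //; [rewrite lieC; apply: subspaceN => //|]; apply: lieJ.
- move=> x v Jx; rewrite (projE x 0) ?subr0 //; last by case: sA0.
  exact: (linear_on0 sA0 (r2 v)).
Qed.

End ExtendsRep.

(** * Homogeneous components *)

Section HomogeneousComponents.
Variables (F : fieldType) (L : gradedLieType F).
Implicit Types x y : L.

Lemma hcomp_subspace n : subspace (hcomp n : set L).
Proof.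
have [C0 CB _ _] := hcomp_is_grading L; split=> // a x y nx ny.
rewrite -[y]opprK -[- y]sub0r; apply: (CB) => //; first exact: hcompZ.
exact: CB.
Qed.

(** The sum formula is asked for all bounds M >= N, so that several decompositions can be compared
    at a common bound. *)
Definition is_decomp x (g : nat -> L) (N : nat) : Prop :=
  [/\ forall n, hcomp n (g n), forall n, (N <= n)%N -> g n = 0 &
      forall M, (N <= M)%N -> x = \sum_(n < M) g n].

Lemma decomp_exists x : exists g N, is_decomp x g N.
Proof.
pose W := [set x | exists g N, is_decomp x g N].
have C0 n : hcomp n (0 : L) by have [] := hcomp_subspace n.
suff sW : subspace W.
  have [_ _ /(_ x) + _] := hcomp_is_grading L.
  move=> [s [f fn ->]]; apply: subspace_sum sW _ => i _.
  exists (fun n => if n == i then f i else 0), i.+1; split.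
  - by move=> n; case: eqP => [->|].
  - by move=> n ni; rewrite gtn_eqF.
  - by move=> M iM; rewrite (bigD1 (Ordinal iM)) //= eqxx big1 ?addr0 // => j; rewrite -val_eqE /= => /negPf->.
split; first by exists (fun=> 0), 0%N; split=> // M _; rewrite big1.
move=> a u v [g [N [gn g0 gs]]] [h [K [hn h0 hs]]].
exists (fun n => a *: g n + h n), (maxn N K); split.
- move=> n; have [_ Cl] := hcomp_subspace n; exact: Cl.
- by move=> n; rewrite geq_max => /andP[Nn Kn]; rewrite g0 // h0 // scaler0 addr0.
- move=> M; rewrite geq_max => /andP[NM KM].
  by rewrite big_split /= -scaler_sumr -gs // -hs.
Qed.

Definition hproj (n : nat) x : L := projT1 (cid (decomp_exists x)) n.

Lemma hproj_decomp x : exists N, is_decomp x (hproj^~ x) N.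
Proof. exact: projT2 (cid (decomp_exists x)). Qed.

Lemma hcomp_hproj n x : hcomp n (hproj n x).
Proof. by have [N []] := hproj_decomp x. Qed.

Lemma decomp_uniq x g N : is_decomp x g N -> forall n, hproj n x = g n.
Proof.
move=> [gn g0 gs] n; have [K [hn h0 hs]] := hproj_decomp x.
pose M := maxn n.+1 (maxn N K).
have [_ CB _ Ci] := hcomp_is_grading L.
apply/eqP; rewrite -subr_eq0; apply/eqP.
apply: (Ci (index_iota 0 M) (fun i => hproj i x - g i)).
- exact: iota_uniq.
- by move=> i; apply: CB.
- rewrite big_mkord sumrB -hs -?gs ?subrr //.
    by rewrite /M !leq_max leqnn orbT.
  by rewrite /M !leq_max leqnn !orbT.
- by rewrite mem_index_iota /M !leq_max leqnn.
Qed.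

Lemma hproj_linear n : linear (hproj n).
Proof.
move=> a x y; have [N [xn x0 xs]] := hproj_decomp x.
have [K [yn y0 ys]] := hproj_decomp y.
apply: (@decomp_uniq _ (fun n => a *: hproj n x + hproj n y) (maxn N K)); split.
- move=> k; have [_ Cl] := hcomp_subspace k; exact: Cl.
- by move=> k; rewrite geq_max => /andP[Nk Kk]; rewrite x0 // y0 // scaler0 addr0.
- move=> M; rewrite geq_max => /andP[NM KM].
  by rewrite big_split /= -scaler_sumr -xs // -ys.
Qed.

Lemma hproj_linear_on n : linear_on setT (hproj n).
Proof. by move=> a x y _ _; apply: hproj_linear. Qed.

Lemma hproj0 n : hproj n 0 = 0.
Proof. exact: (linear_on0 (subspaceT _) (@hproj_linear_on n)). Qed.
Lemma hprojB n x y : hproj n (x - y) = hproj n x - hproj n y.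
Proof. exact: (linear_onB (subspaceT _) (@hproj_linear_on n)). Qed.
Lemma hproj_sum n (I : Type) (s : seq I) (P : pred I) (f : I -> L) :
  hproj n (\sum_(i <- s | P i) f i) = \sum_(i <- s | P i) hproj n (f i).
Proof. exact: (linear_on_sum (subspaceT _) (@hproj_linear_on n)). Qed.

Lemma hproj_hcomp n m x : hcomp m x -> hproj n x = if n == m then x else 0.
Proof.
move=> mx; apply: (@decomp_uniq _ (fun n => if n == m then x else 0) m.+1); split.
- by move=> k; case: eqP => [->|] //; have [] := hcomp_subspace k.
- by move=> k mk; rewrite gtn_eqF.
- by move=> M iM; rewrite (bigD1 (Ordinal iM)) //= eqxx big1 ?addr0 // => j; rewrite -val_eqE /= => /negPf->.
Qed.

Lemma hproj_id n x : hcomp n x -> hproj n x = x.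
Proof. by move=> /hproj_hcomp->; rewrite eqxx. Qed.

Lemma hproj0E x : hproj 0 x = 0.
Proof. exact/hcomp0/hcomp_hproj. Qed.

Lemma hproj_lie n x y :
  hproj n (lie x y) = \sum_(i < n.+1) lie (hproj i x) (hproj (n - i) y).
Proof.
have [N [_ x0 xs]] := hproj_decomp x; have [K [_ y0 ys]] := hproj_decomp y.
pose M := maxn n.+1 (maxn N K).
have nM : (n.+1 <= M)%N by rewrite /M leq_max leqnn.
have NM : (N <= M)%N by rewrite /M !leq_max leqnn orbT.
have KM : (K <= M)%N by rewrite /M !leq_max leqnn !orbT.
rewrite {1}(xs M NM) {1}(ys M KM) lie_suml hproj_sum.
rewrite [RHS](big_ord_widen M (fun i => lie (hproj i x) (hproj (n - i) y))) //.
rewrite [RHS]big_mkcond; apply: eq_bigr => i _.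
rewrite lie_sumr hproj_sum.
have hE (j : 'I_M) : hproj n (lie (hproj i x) (hproj j y)) =
    if n == (i + j)%N then lie (hproj i x) (hproj j y) else 0.
  by apply: hproj_hcomp; apply: hcomp_lie; apply: hcomp_hproj.
under eq_bigr => j _ do rewrite hE.
case: ltnP => [ltin|ltni]; last first.
  by rewrite big1 // => j _; rewrite ltn_eqF // ltn_addr.
have ltM : (n - i < M)%N by rewrite (leq_trans _ nM) // ltnS leq_subr.
rewrite (bigD1 (Ordinal ltM)) //= subnKC // eqxx big1 ?addr0 // => j.
rewrite -val_eqE /= => jn; case: eqP => // nE.
by rewrite nE addKn eqxx in jn.
Qed.

Lemma hproj_inj x y : (forall n, hproj n x = hproj n y) -> x = y.
Proof.
move=> xy; have [N [_ _ xs]] := hproj_decomp x; have [K [_ _ ys]] := hproj_decomp y.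
rewrite (xs (maxn N K)) ?leq_maxl // (ys (maxn N K)) ?leq_maxr //.
by apply: eq_bigr.
Qed.

Definition hideal (n : nat) : set L := [set x | forall k, (k <= n)%N -> hproj k x = 0].

Lemma hideal_subspace n : subspace (hideal n).
Proof.
split=> [k _|a x y nx ny k kn]; first exact: hproj0.
by rewrite hproj_linear nx // ny // scaler0 addr0.
Qed.

(** Degree 0 vanishes, so bracketing with any element raises the degree by at least one. This is the
    nilpotency that makes each layer of the filtration abelian. *)
Lemma hideal_lieS n x y : hideal n y -> hideal n.+1 (lie x y).
Proof.
move=> ny k kn; rewrite hproj_lie big1 // => -[[|i] ltik] _ /=.
  by rewrite hproj0E lie0l.
by rewrite [hproj (k - _) y]ny ?lie0r // leq_subLR addSn (leq_trans kn) // ltnS leq_addl.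
Qed.

Lemma hidealS n : hideal n.+1 `<=` hideal n.
Proof. by move=> x nx k kn; apply: nx; apply: leqW. Qed.

Lemma hideal_lie n x y : hideal n y -> hideal n (lie x y).
Proof. by move=> /(hideal_lieS x)/hidealS. Qed.

Lemma hideal0 x : hideal 0 x.
Proof. by move=> [|k] // _; apply: hproj0E. Qed.

Lemma hideal_hproj n x : hideal n x -> hideal n.+1 (x - hproj n.+1 x).
Proof.
move=> nx k; rewrite leq_eqVlt => /predU1P[->|kn].
  by rewrite hprojB (hproj_id (hcomp_hproj _ _)) subrr.
rewrite hprojB nx // (hproj_hcomp _ (hcomp_hproj _ _)) ltn_eqF // subr0 //.
Qed.

End HomogeneousComponents.

Lemma hproj_hom (F : fieldType) (L M : gradedLieType F) (f : L -> M) n x :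
  graded_lie_hom f -> hproj n (f x) = f (hproj n x).
Proof.
move=> [[fl _] fd]; have [N [_ x0 xs]] := hproj_decomp x.
have fl' : linear_on setT f by move=> a u v _ _; apply: fl.
have f0 : f 0 = 0 := linear_on0 (subspaceT _) fl'.
apply: (@decomp_uniq _ _ _ (fun n => f (hproj n x)) N); split.
- by move=> k; apply/fd/hcomp_hproj.
- by move=> k Nk; rewrite x0.
- move=> K NK; rewrite {1}(xs K NK).
  exact: (linear_on_sum (subspaceT _) fl').
Qed.

Definition fin_spanned (F : fieldType) (V : lmodType F) (W : set V) : Prop :=
  exists e : seq V, W `<=` add_span [set 0] e.

Lemma fin_dim_spanned (F : fieldType) (V : lmodType F) (W : set V) :
  fin_dim W -> fin_spanned W.
Proof.
move=> [n [e We]]; exists [seq e i | i <- enum 'I_n] => x /We[c ->].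
have sS := add_span_subspace [seq e i | i <- enum 'I_n] (subspace0 V).
apply: subspace_sum => // i _; apply: subspaceZ => //.
by apply: mem_add_span; [exact: subspace0 | apply: map_f; rewrite mem_enum].
Qed.

Definition locally_finite (F : fieldType) (L : gradedLieType F) : Prop :=
  forall n, fin_spanned (hcomp n : set L).

(** In degree n only the generators (when n = 1) and the brackets of components of degrees i and n -
    i contribute; the extreme terms i = 0 and i = n vanish because degree 0 is zero. *)
Lemma lie_span_hproj (F : fieldType) (L : gradedLieType F) (S W : set L) n :
    S `<=` hcomp 1 -> subspace W ->
    (n = 1%N -> S `<=` W) ->
    (forall i x y, (0 < i < n)%N -> W (lie (hproj i x) (hproj (n - i) y))) ->
  forall x, lie_span S x -> W (hproj n x).
Proof.
move=> S1 sW SW lieW x; elim=> {x} [x Sx||a x y _ Wx _ Wy|x y _ _ _ _].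
- rewrite (hproj_hcomp n (S1 x Sx)); case: eqP => [n1|_]; last by case: sW.
  exact: SW.
- by rewrite hproj0; case: sW.
- by rewrite hproj_linear; case: sW => _; apply.
- rewrite hproj_lie; apply: subspace_sum => // i _.
  have [i0|i0] := posnP i; first by rewrite i0 hproj0E lie0l; case: sW.
  have := ltn_ord i; rewrite ltnS leq_eqVlt => /predU1P[->|iltn].
    by rewrite subnn hproj0E lie0r; case: sW.
  by apply: lieW; rewrite i0.
Qed.

(** By strong induction: the component of degree n > 1 is spanned by the brackets of the spanning
    lists found in degrees i and n - i. *)
Lemma one_generated_locally_finite (F : fieldType) (L : gradedLieType F) :
  one_generated L -> fin_spanned (hcomp 1 : set L) -> locally_finite L.
Proof.
move=> gL fin1 n; elim/ltn_ind: n => n IHn.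
have [->//|n1] := eqVneq n 1%N.
have /choice[e eP] : forall k, exists e : seq L,
    (k < n)%N -> hcomp k `<=` add_span [set 0] e.
  by move=> k; have [kn|] := ltnP k n; [have [e] := IHn k kn; exists e | exists [::]].
pose l := flatten [seq allpairs lie (e i) (e (n - i)%N) | i <- iota 0 n].
have sl := add_span_subspace l (subspace0 L).
exists l => x nx; rewrite -(hproj_id nx).
apply: (@lie_span_hproj _ _ (hcomp 1)) => //.
  by move=> n1'; rewrite n1' in n1.
move=> i u v /andP[i0 iltn].
have key : forall y, add_span [set 0] (e (n - i)%N) y ->
    forall z, add_span [set 0] (e i) z -> add_span [set 0] l (lie z y).
  move=> y ey; apply: linear_on_add_span => //; first exact: subspace0.
  - by move=> a z z' _ _; rewrite lie_linearl.
  - by move=> z ->; rewrite lie0l; case: sl.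
  - move=> z ze; move: y ey; apply: linear_on_add_span => //; first exact: subspace0.
    + by move=> a y y' _ _; rewrite lie_linearr.
    + by move=> y ->; rewrite lie0r; case: sl.
    + move=> y ye; apply: mem_add_span; first exact: subspace0.
      apply/flattenP; exists (allpairs lie (e i) (e (n - i)%N)).
        by apply/mapP; exists i; rewrite // mem_iota.
      by apply/allpairsP; exists (z, y).
apply: key.
  by apply: (eP); [rewrite ltn_subrL i0 (leq_trans _ iltn) | apply: hcomp_hproj].
by apply: (eP) => //; apply: hcomp_hproj.
Qed.

(** * Extending nilpotent representations *)

Section GradedExtension.
Variables (F : fieldType) (A : gradedLieType F) (A0 : set A).
Hypotheses (sA0 : subspace A0) (lA0 : lie_closed A0) (lfA : locally_finite A).
Variables (Z : lmodType F) (rho0 : A -> Z -> Z) (N : nat).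
Hypothesis rep0 : is_rep A0 rho0.
Hypothesis rho0N : forall x v, A0 x -> hideal N x -> rho0 x v = 0.

(** A0 + A_{>n}. These subalgebras descend from the whole of [A] at n = 0, and by [add_hideal_lie]
    each contains the brackets of its predecessor, so that the extension through one layer is
    abelian. *)
Definition add_hideal n : set A := [set x | exists2 a, A0 a & hideal n (x - a)].

Lemma add_hideal_subspace n : subspace (add_hideal n).
Proof.
have [A00 A0l] := sA0; have [J0 Jl] := hideal_subspace A n.
split; first by exists 0; rewrite ?subrr.
move=> c x y [a A0a Ja] [b A0b Jb]; exists (c *: a + b); first exact: A0l.
by rewrite opprD addrACA -scalerBr; apply: Jl.
Qed.

Lemma sub_add_hideal n : A0 `<=` add_hideal n.
Proof. by move=> a A0a; exists a; rewrite // subrr; case: (hideal_subspace A n). Qed.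

Lemma add_hidealS n : add_hideal n.+1 `<=` add_hideal n.
Proof. by move=> x [a A0a /hidealS Ja]; exists a. Qed.

Lemma hideal_add_hideal n : (n <= N)%N -> hideal N `<=` add_hideal n.
Proof.
move=> nN x Nx; exists 0; first by case: sA0.
by rewrite subr0 => k kn; apply: Nx; apply: leq_trans nN.
Qed.

Lemma add_hideal0 : add_hideal 0 = setT.
Proof.
apply/seteqP; split=> // x _; exists 0; first by case: sA0.
exact: hideal0.
Qed.

Lemma add_hideal_lie n x y :
  add_hideal n x -> add_hideal n y -> add_hideal n.+1 (lie x y).
Proof.
move=> [a A0a Ja] [b A0b Jb]; exists (lie a b); first exact: lA0.
rewrite -[x](subrK a) lieDl -addrA -[X in lie a X](subrK b) lieDr addrK.
apply: (subspaceD (hideal_subspace A _)); last exact: hideal_lieS.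
by rewrite lieC; apply: (subspaceN (hideal_subspace A _)); exact: hideal_lieS.
Qed.

Lemma add_hideal_lie_closed n : lie_closed (add_hideal n).
Proof. by move=> x y nx ny; apply/add_hidealS/add_hideal_lie. Qed.

Lemma add_hideal_span n :
  exists e, add_hideal n `<=` add_span (add_hideal n.+1) e.
Proof.
have [e eP] := lfA n.+1; exists e => x [a A0a Ja].
have sU := add_hideal_subspace n.+1; have sS := add_span_subspace e sU.
rewrite -[x](subrK (hproj n.+1 (x - a))); apply: subspaceD => //.
  apply: sub_add_span; exists a => //.
  by rewrite addrAC; apply: hideal_hproj.
apply: (@add_span_min _ _ [set 0] _ e) => //.
- by move=> y ->; case: sS.
- by move=> y ye; apply: mem_add_span.
- by apply: eP; apply: hcomp_hproj.
Qed.

Lemma extends_rep_layer n d0 d : (n.+1 <= N)%N ->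
    (forall x, x \in d0 -> add_hideal n.+1 x) ->
    (forall x, x \in d -> add_hideal n x) -> free_mod (add_hideal n.+1) d ->
    extends_rep A0 rho0 (hideal N) (add_hideal n.+1) d0 ->
  extends_rep A0 rho0 (hideal N) (add_hideal n) (d0 ++ d).
Proof.
move=> nN d0U dU fd; have [e eP] := add_hideal_span n.
apply: (@extends_rep_abelian _ _ _ _ _ _ _ _ _ _ _ e) => //.
- exact: hideal_lie.
- exact: add_hideal_subspace.
- exact: add_hideal_subspace.
- exact: add_hideal_lie_closed.
- exact: add_hideal_lie.
- exact: add_hidealS.
- exact: sub_add_hideal.
- exact: hideal_add_hideal.
Qed.

Lemma extends_rep_layers n m d : (m + n <= N)%N ->
    (forall x, x \in d -> add_hideal (m + n) x) ->
    extends_rep A0 rho0 (hideal N) (add_hideal (m + n)) d ->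
  extends_rep A0 rho0 (hideal N) (add_hideal n) d.
Proof.
elim: m => [//|m IHm] mN dU ext; rewrite addSn in mN dU ext.
apply: IHm; first exact: ltnW.
  by move=> x /dU/add_hidealS.
by rewrite -[d]cats0; apply: extends_rep_layer.
Qed.

(** The representation is extended from A0 + A_{>N} up to [A], layer by layer. The directions [d]
    all live in the layer between A0 + A_{>n+1} and A0 + A_{>n}, that is in degree n + 1, and are
    prescribed there together; the other layers are crossed without prescribing anything. *)
Theorem extends_rep_graded n d : (n.+1 <= N)%N ->
    (forall x, x \in d -> add_hideal n x) -> free_mod (add_hideal n.+1) d ->
  extends_rep A0 rho0 (hideal N) setT d.
Proof.
move=> nN dU fd; rewrite -add_hideal0; apply: (@extends_rep_layers _ n).
- by rewrite addn0 ltnW.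
- by rewrite addn0.
rewrite addn0 -[d]cat0s; apply: extends_rep_layer => //.
apply: (@extends_rep_layers _ (N - n.+1)); rewrite subnK //.
apply: extends_rep_ideal => //; [exact: hideal_lie|exact: hideal_subspace].
Qed.

End GradedExtension.

(* PBW for nilpotent quotients: a nonzero m lies in some layer, and it acts
   nontrivially on a representation extending the trivial one in that layer. *)
Lemma exists_rep_neq0 (F : fieldType) (M : gradedLieType F) (m : M) :
    locally_finite M -> m != 0 ->
  exists N (Z : lmodType F) (rho : M -> Z -> Z),
    [/\ is_rep setT rho, forall x v, hideal N x -> rho x v = 0 &
        exists v, rho m v != 0].
Proof.
move=> lfM m0.
have [n nm Nnm] : exists2 n, hideal n m & ~ hideal n.+1 m.
  apply: contrapT => H; case/eqP: m0; apply: hproj_inj => n.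
  suff /(_ n) : forall n, hideal n m by move=> /(_ n (leqnn _))->; rewrite hproj0.
  elim=> [|k IHk]; first exact: hideal0.
  by apply: contrapT => Hk; apply: H; exists k.
(* Here A0 = 0 acts on the line [F^o] by zero, and the single direction is m: the projection of m v
   can be prescribed, and the value 1 shows that m v is nonzero. *)
have := @extends_rep_graded _ M [set 0] (subspace0 _) _ lfM F^o (fun _ _ => 0)
  n.+1 _ _ n [:: m] (leqnn _) _ _.
have zeroE k : add_hideal [set 0] k = hideal k :> set M.
  apply/seteqP; split=> x; first by move=> [a ->]; rewrite subr0.
  by move=> kx; exists 0; rewrite ?subr0.
rewrite !zeroE; case=> //.
- by move=> x y -> ->; rewrite lie0l.
- split=> [x _ a z z'|z a x y _ _|x y z _ _]; rewrite ?subrr ?scaler0 ?addr0 //.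
- by move=> x; rewrite inE => /eqP->.
move=> Z [rho [pi [s [rr rN [pil _] _ sP]]]]; exists n.+1, Z, rho; split=> //.
have [_ /(_ 0%N isT) /= pi1] := sP 0 (fun=> 1).
exists (s 0 (fun=> 1)); apply/eqP => r0; move: pi1; rewrite r0.
have pil' : linear_on setT pi by move=> a x y _ _; apply: pil.
by rewrite (linear_on0 (subspaceT _) pil') => /eqP; rewrite eq_sym oner_eq0.
Qed.

(** * The Lie algebras End(Q) and t M[t] *)

Section EndLie.
Variables (F : fieldType) (Q : lmodType F).

Record lin_end : Type :=
  LinEnd { lin_end_val : Q -> Q; _ : lin_end_val \in [set f | linear f] }.
HB.instance Definition _ := [isSub for lin_end_val].
HB.instance Definition _ := [Choice of lin_end by <:].

Fact lin_end_submod_closed :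
  GRing.submod_closed (mem [set f : Q -> Q | linear f]).
Proof.
split=> [|a f g]; rewrite !inE /=.
  by move=> b x y; rewrite /= scaler0 addr0.
move=> fl gl b x y; rewrite -[LHS]/(a *: f _ + g _) fl gl.
rewrite -[RHS]/(b *: (a *: f x + g x) + (a *: f y + g y)).
by rewrite !scalerDr !scalerA [a * b]mulrC addrACA.
Qed.
HB.instance Definition _ :=
  GRing.SubChoice_isSubLmodule.Build F (Q -> Q) _ lin_end
    (GRing.submod_closed_semi lin_end_submod_closed).

Lemma lin_endP (f : lin_end) : linear (val f).
Proof. by have := valP f; rewrite inE. Qed.
Lemma lin_end_linear_on (f : lin_end) : linear_on setT (val f).
Proof. by move=> a x y _ _; apply: lin_endP. Qed.
Lemma lin_endB (f : lin_end) x y : val f (x - y) = val f x - val f y.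
Proof. exact: (linear_onB (subspaceT _) (lin_end_linear_on f)). Qed.

Fact lin_end_lie_subproof (f g : lin_end) :
  (fun x => val f (val g x) - val g (val f x)) \in [set f : Q -> Q | linear f].
Proof.
rewrite inE => a x y; rewrite /= !lin_endP opprD addrACA.
by rewrite scalerBr.
Qed.
Definition lin_end_lie f g : lin_end := LinEnd (lin_end_lie_subproof f g).

Fact lin_end_lieEl f g x : val (lin_end_lie f g) x = val f (val g x) - val g (val f x).
Proof. by []. Qed.

Fact lin_end_linearl (h : lin_end) (a : F) f g :
  lin_end_lie (a *: f + g) h = a *: lin_end_lie f h + lin_end_lie g h.
Proof.
apply/val_inj/funext => x.
rewrite -[LHS]/(a *: val f (val h x) + val g (val h x)
  - val h (a *: val f x + val g x)) lin_endP.
rewrite -[RHS]/(a *: (val f (val h x) - val h (val f x)) + (val g (val h x) - val h (val g x))).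
by rewrite opprD addrACA scalerBr.
Qed.
Fact lin_end_linearr (h : lin_end) (a : F) f g :
  lin_end_lie h (a *: f + g) = a *: lin_end_lie h f + lin_end_lie h g.
Proof.
apply/val_inj/funext => x.
rewrite -[LHS]/(val h (a *: val f x + val g x)
  - (a *: val f (val h x) + val g (val h x))) lin_endP.
rewrite -[RHS]/(a *: (val h (val f x) - val f (val h x)) + (val h (val g x) - val g (val h x))).
by rewrite opprD addrACA scalerBr.
Qed.
Fact lin_end_liexx f : lin_end_lie f f = 0.
Proof. by apply/val_inj/funext => x; rewrite lin_end_lieEl subrr. Qed.
Fact lin_end_jacobi f g h :
  lin_end_lie f (lin_end_lie g h) + lin_end_lie g (lin_end_lie h f)
  + lin_end_lie h (lin_end_lie f g) = 0.
Proof.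
apply/val_inj/funext => x.
rewrite -[LHS]/(val (lin_end_lie f (lin_end_lie g h)) x
  + val (lin_end_lie g (lin_end_lie h f)) x
  + val (lin_end_lie h (lin_end_lie f g)) x) !lin_end_lieEl !lin_endB.
rewrite -[RHS]/(0 : Q) !opprB !addrA.
(* The twelve triple composites cancel in pairs. *)
by rewrite [LHS](ACl ((1*12)*(11*6)*(3*10)*(9*8)*(7*2)*(5*4))) /= !subrr !addr0.
Qed.
HB.instance Definition _ := Lmodule_isLie.Build F lin_end
  lin_end_linearl lin_end_linearr lin_end_liexx lin_end_jacobi.

Lemma lin_end_lieE (f g : lin_end) x :
  val (lie f g) x = val f (val g x) - val g (val f x).
Proof. by []. Qed.
End EndLie.

(** * The graded Lie algebra t M[t] of an ungraded Lie algebra M *)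

Section PolynomialLie.
Variables (F : fieldType) (M : lieType F).

(** Coefficients of polynomials without constant term. The power of t provides a grading whatever
    [M] is, and the constant term is excluded because an N-graded Lie algebra is zero in degree
    0. *)
Definition tpoly_set : set (nat -> M) :=
  [set s | s 0%N = 0 /\ exists N, forall n, (N <= n)%N -> s n = 0].

Record tpoly : Type := TPoly { tcoef : nat -> M; _ : tcoef \in tpoly_set }.
HB.instance Definition _ := [isSub for tcoef].
HB.instance Definition _ := [Choice of tpoly by <:].

Fact tpoly_submod_closed : GRing.submod_closed (mem tpoly_set).
Proof.
split=> [|a f g]; rewrite !inE /=; first by split=> //; exists 0%N.
move=> [f0 [N fN]] [g0 [K gK]]; split.
  by rewrite -[LHS]/(a *: f 0%N + g 0%N) f0 g0 scaler0 addr0.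
exists (maxn N K) => n; rewrite geq_max => /andP[Nn Kn].
by rewrite -[LHS]/(a *: f n + g n) fN // gK // scaler0 addr0.
Qed.
HB.instance Definition _ :=
  GRing.SubChoice_isSubLmodule.Build F (nat -> M) _ tpoly
    (GRing.submod_closed_semi tpoly_submod_closed).

Implicit Types p q r : tpoly.

Lemma tcoef0 p : tcoef p 0 = 0.
Proof. by have := valP p; rewrite inE => -[]. Qed.
Lemma tcoef_fin p : exists N, forall n, (N <= n)%N -> tcoef p n = 0.
Proof. by have := valP p; rewrite inE => -[]. Qed.
Lemma tcoefD p q n : tcoef (p + q) n = tcoef p n + tcoef q n.
Proof. by []. Qed.
Lemma tcoefZ a p n : tcoef (a *: p) n = a *: tcoef p n.
Proof. by []. Qed.
Lemma tcoef_0 n : tcoef 0 n = 0.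
Proof. by []. Qed.
Lemma tpoly_ext p q : (forall n, tcoef p n = tcoef q n) -> p = q.
Proof. by move=> pq; apply/val_inj/funext. Qed.

(** The Cauchy product, written as a double sum with a condition instead of an index n - i: ranges
    can then be enlarged ([tconvE]) and sums exchanged freely. *)
Definition tconv (x y : nat -> M) (n : nat) : M :=
  \sum_(i < n.+1) \sum_(j < n.+1) if n == (i + j)%N then lie (x i) (y j) else 0.

Lemma tconvE K x y n : (n < K)%N -> tconv x y n =
  \sum_(i < K) \sum_(j < K) if n == (i + j)%N then lie (x i) (y j) else 0.
Proof.
move=> nK; rewrite /tconv.
rewrite (big_ord_widen K (fun i => \sum_(j < n.+1)
  if n == (i + j)%N then lie (x i) (y j) else 0)) // big_mkcond.
apply: eq_bigr => i _; case: ltnP => [iltn|ni]; last first.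
  by rewrite big1 // => j _; rewrite ltn_eqF // ltn_addr.
rewrite (big_ord_widen K (fun j => if n == (i + j)%N then lie (x i) (y j) else 0)) //.
rewrite big_mkcond; apply: eq_bigr => j _; case: ltnP => // nj.
by rewrite ltn_eqF // ltn_addl.
Qed.

Fact tpoly_lie_subproof p q : tconv (tcoef p) (tcoef q) \in tpoly_set.
Proof.
rewrite inE; split.
  by rewrite /tconv big1 // => i _; rewrite big1 // => j _; rewrite [i]ord1 tcoef0 lie0l if_same.
have [N pN] := tcoef_fin p; have [K qK] := tcoef_fin q.
exists (N + K)%N => n NKn; rewrite /tconv big1 // => i _; rewrite big1 // => j _.
case: eqP => // nE; have [Ni|iN] := leqP N i; first by rewrite pN // lie0l.
rewrite qK ?lie0r // -(leq_add2l N); apply: (leq_trans NKn).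
by rewrite {1}nE leq_add2r ltnW.
Qed.
Definition tpoly_lie p q : tpoly := TPoly (tpoly_lie_subproof p q).

Fact tcoef_tpoly_lie p q n :
  tcoef (tpoly_lie p q) n = tconv (tcoef p) (tcoef q) n.
Proof. by []. Qed.

Fact tpoly_linearl q (a : F) p p' :
  tpoly_lie (a *: p + p') q = a *: tpoly_lie p q + tpoly_lie p' q.
Proof.
apply: tpoly_ext => n; rewrite tcoefD tcoefZ !tcoef_tpoly_lie /tconv.
rewrite scaler_sumr -big_split.
apply: eq_bigr => i _; rewrite scaler_sumr -big_split; apply: eq_bigr => j _.
case: eqP => _; first by rewrite tcoefD tcoefZ lie_linearl.
by rewrite /= scaler0 addr0.
Qed.
Fact tpoly_linearr q (a : F) p p' :
  tpoly_lie q (a *: p + p') = a *: tpoly_lie q p + tpoly_lie q p'.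
Proof.
apply: tpoly_ext => n; rewrite tcoefD tcoefZ !tcoef_tpoly_lie /tconv.
rewrite scaler_sumr -big_split.
apply: eq_bigr => i _; rewrite scaler_sumr -big_split; apply: eq_bigr => j _.
case: eqP => _; first by rewrite tcoefD tcoefZ lie_linearr.
by rewrite /= scaler0 addr0.
Qed.

(** Terms in positions (i, j) and (j, i) cancel. The diagonal needs its own hypothesis: in
    characteristic 2 antisymmetry does not make it vanish. *)
Lemma alternating_sum K (f : nat -> nat -> M) :
    (forall i, f i i = 0) -> (forall i j, f i j = - f j i) ->
  \sum_(i < K) \sum_(j < K) f i j = 0.
Proof.
move=> f0 fN; elim: K => [|K IHK]; first by rewrite big_ord0.
rewrite big_ord_recr /= (eq_bigr (fun i : 'I_K => \sum_(j < K) f i j + f i K)).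
  rewrite big_split /= IHK add0r big_ord_recr /= f0 addr0 -big_split big1 //.
  by move=> i _; rewrite /= fN addNr.
by move=> i _; rewrite big_ord_recr.
Qed.

Fact tpoly_liexx p : tpoly_lie p p = 0.
Proof.
apply: tpoly_ext => n; rewrite tcoef_0 /= /tconv.
apply: (@alternating_sum _ (fun i j =>
  if n == (i + j)%N then lie (tcoef p i) (tcoef p j) else 0)).
  by move=> i; rewrite liexx if_same.
by move=> i j; rewrite addnC; case: eqP => _; rewrite ?oppr0 // lieC.
Qed.

Lemma tconv3E x y z n : tconv x (tconv y z) n =
  \sum_(i < n.+1) \sum_(j < n.+1) \sum_(k < n.+1)
    if n == (i + (j + k))%N then lie (x i) (lie (y j) (z k)) else 0.
Proof.
rewrite {1}/tconv; apply: eq_bigr => i _.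
transitivity (\sum_(m < n.+1) \sum_(j < n.+1) \sum_(k < n.+1)
   if (n == (i + m)%N) && (m == (j + k)%N :> nat) then lie (x i) (lie (y j) (z k)) else 0).
  apply: eq_bigr => m _; rewrite (@tconvE n.+1) //.
  case: eqP => _ /=; last by rewrite big1 // => j _; rewrite big1.
  rewrite lie_sumr; apply: eq_bigr => j _; rewrite lie_sumr; apply: eq_bigr => k _.
  by case: ifP => // _; rewrite lie0r.
rewrite exchange_big; apply: eq_bigr => j _; rewrite exchange_big.
apply: eq_bigr => k _ /=; case: eqP => [nE|nE]; last first.
  by rewrite big1 // => m _; case: andP => // -[/eqP nm /eqP mjk]; case: nE; rewrite -mjk.
have jk : (j + k < n.+1)%N by rewrite ltnS [leqRHS]nE leq_addl.
rewrite (bigD1 (Ordinal jk)) //= -nE !eqxx big1 ?addr0 //= => m.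
by rewrite -val_eqE /= => /negPf->; rewrite andbF.
Qed.

Fact tpoly_jacobi p q r :
  tpoly_lie p (tpoly_lie q r) + tpoly_lie q (tpoly_lie r p)
  + tpoly_lie r (tpoly_lie p q) = 0.
Proof.
apply: tpoly_ext => n; rewrite !tcoefD tcoef_0 /= !tconv3E.
(* The second and third triple sums are reindexed by the same (i, j, k) as the first; the Jacobi
   identity of [M] then applies term by term. *)
rewrite [X in _ + X + _](eq_bigr (fun j : 'I_n.+1 => \sum_(i < n.+1) \sum_(k < n.+1)
    if n == (j + (k + i))%N then lie (tcoef q j) (lie (tcoef r k) (tcoef p i)) else 0)); last first.
  by move=> j _; apply: exchange_big.
rewrite [X in _ + X + _]exchange_big /=.
rewrite [X in _ + _ + X]exchange_big /=.
rewrite [X in _ + _ + X](eq_bigr (fun i : 'I_n.+1 => \sum_(j < n.+1) \sum_(k < n.+1)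
    if n == (k + (i + j))%N then lie (tcoef r k) (lie (tcoef p i) (tcoef q j)) else 0)); last first.
  by move=> i _; apply: exchange_big.
rewrite -!big_split big1 // => i _ /=; rewrite -!big_split big1 // => j _ /=.
rewrite -!big_split big1 // => k _ /=.
have -> : (j + (k + i) = i + (j + k))%N by rewrite addnA addnC.
have -> : (k + (i + j) = i + (j + k))%N by rewrite addnC addnA.
by case: eqP => _; rewrite ?addr0 // lie_jacobi.
Qed.

HB.instance Definition _ := Lmodule_isLie.Build F tpoly
  tpoly_linearl tpoly_linearr tpoly_liexx tpoly_jacobi.

Definition tpoly_hcomp n : set tpoly := [set p | forall k, k <> n -> tcoef p k = 0].

Lemma tmono_subproof n (x : M) :
  (fun k => if (k == n) && (0 < n)%N then x else 0) \in tpoly_set.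
Proof.
rewrite inE; split; first by case: n.
by exists n.+1 => k nk; rewrite gtn_eqF.
Qed.
(* Junk: [tmono 0 x = 0]. *)
Definition tmono n x : tpoly := TPoly (tmono_subproof n x).

Lemma tcoef_sum (I : Type) (s : seq I) (P : pred I) (f : I -> tpoly) n :
  tcoef (\sum_(i <- s | P i) f i) n = \sum_(i <- s | P i) tcoef (f i) n.
Proof. by elim/big_rec2: _ => // i x y _ <-. Qed.

Fact tpoly_grading : is_grading tpoly_hcomp.
Proof.
split=> //.
- move=> n p q np nq k kn.
  by rewrite -[LHS]/(tcoef p k - tcoef q k) np // nq // subrr.
- move=> p; have [N pN] := tcoef_fin p.
  exists (index_iota 0 N), (fun n => tmono n (tcoef p n)).
    by move=> n k /eqP/negPf kn /=; rewrite kn.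
  apply: tpoly_ext => n; rewrite tcoef_sum big_mkord /=.
  have [->|n0] := posnP n; first by rewrite tcoef0 big1 // => -[[|i] ?].
  have [Nn|nN] := leqP N n.
    by rewrite pN // big1 // => i _; rewrite gtn_eqF // (leq_trans _ Nn).
  rewrite (bigD1 (Ordinal nN)) //= eqxx n0 big1 ?addr0 // => i.
  by rewrite -val_eqE /= eq_sym => /negPf->.
- move=> s f us fC sum0 i si; apply: tpoly_ext => n; rewrite tcoef_0.
  have [ni|/eqP/(fC i)->//] := eqVneq n i; rewrite ni.
  have := congr1 (tcoef^~ i) sum0; rewrite tcoef_sum (bigD1_seq i) //= big1 ?addr0 //.
  by move=> k /eqP ki; apply: (fC k) => /esym.
Qed.
Fact tpoly_hcompZ n (a : F) p : tpoly_hcomp n p -> tpoly_hcomp n (a *: p).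
Proof. by move=> np k kn; rewrite tcoefZ np // scaler0. Qed.
Fact tpoly_hcomp0 p : tpoly_hcomp 0 p -> p = 0.
Proof. by move=> p0; apply: tpoly_ext => -[|n]; rewrite ?tcoef0 // p0. Qed.
Fact tpoly_hcomp_lie n m p q :
  tpoly_hcomp n p -> tpoly_hcomp m q -> tpoly_hcomp (n + m) (lie p q).
Proof.
move=> np mq k knm; rewrite -[LHS]/(tconv (tcoef p) (tcoef q) k) /tconv.
rewrite big1 // => i _; rewrite big1 // => j _.
case: eqP => // kE; have [iE|/eqP ni] := eqVneq (i : nat) n; last first.
  by rewrite np // lie0l.
by rewrite [tcoef q j]mq ?lie0r // => jE; apply: knm; rewrite kE iE jE.
Qed.

HB.instance Definition _ := LieAlgebra_isGraded.Build F tpoly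
  tpoly_grading tpoly_hcompZ tpoly_hcomp0 tpoly_hcomp_lie.

(** Evaluation at t = 1. The bound chosen by [cid] is immaterial, by [tevalE]. *)
Definition teval p : M := \sum_(i < projT1 (cid (tcoef_fin p))) tcoef p i.

Lemma tevalE N p : (forall n, (N <= n)%N -> tcoef p n = 0) ->
  teval p = \sum_(i < N) tcoef p i.
Proof.
rewrite /teval; case: cid => K /= pK pN.
have sup K' K2 : (K' <= K2)%N -> (forall n, (K' <= n)%N -> tcoef p n = 0) ->
    \sum_(i < K') tcoef p i = \sum_(i < K2) tcoef p i.
  move=> KK pK'; rewrite (big_ord_widen K2 (tcoef p)) //.
  by rewrite big_mkcond; apply: eq_bigr => i _; case: ltnP => // /pK'.
by rewrite (sup _ _ (leq_maxl K N) pK) (sup _ _ (leq_maxr K N) pN).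
Qed.

Lemma teval_lie_hom : lie_hom teval.
Proof.
split=> [a p q|p q].
  have [N pN] := tcoef_fin p; have [K qK] := tcoef_fin q.
  have pM n : (maxn N K <= n)%N -> tcoef p n = 0 by rewrite geq_max => /andP[/pN].
  have qM n : (maxn N K <= n)%N -> tcoef q n = 0 by rewrite geq_max => /andP[_ /qK].
  rewrite !(@tevalE (maxn N K)) //; last first.
    by move=> n Mn; rewrite tcoefD tcoefZ pM // qM // scaler0 addr0.
  by rewrite scaler_sumr -big_split.
have [N pN] := tcoef_fin p; have [K qK] := tcoef_fin q.
pose M0 := (N + K)%N.
have pM n : (M0 <= n)%N -> tcoef p n = 0.
  by move=> Mn; apply: pN; apply: leq_trans Mn; apply: leq_addr.
have qM n : (M0 <= n)%N -> tcoef q n = 0.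
  by move=> Mn; apply: qK; apply: leq_trans Mn; apply: leq_addl.
rewrite (tevalE pM) (tevalE qM) lie_suml.
rewrite (@tevalE (M0 + M0)); last first.
  move=> n Mn; rewrite -[LHS]/(tconv (tcoef p) (tcoef q) n) /tconv.
  rewrite big1 // => i _; rewrite big1 // => j _; case: eqP => // nE.
  have [Mi|iM] := leqP M0 i; first by rewrite pM // lie0l.
  rewrite qM ?lie0r // -(leq_add2l M0); apply: (leq_trans Mn).
  by rewrite {1}nE leq_add2r ltnW.
(* Both polynomials vanish from M0 on, so M0 + M0 bounds every i + j that matters. Summing over n
   first leaves each bracket once, and the indices beyond M0 contribute nothing. *)
transitivity (\sum_(n < M0 + M0) \sum_(i < M0 + M0) \sum_(j < M0 + M0)
   if n == (i + j)%N :> nat then lie (tcoef p i) (tcoef q j) else 0).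
  by apply: eq_bigr => n _; rewrite -[LHS]/(tconv (tcoef p) (tcoef q) n) (@tconvE (M0 + M0)).
rewrite exchange_big big_split_ord /= [X in _ + X]big1 ?addr0; last first.
  move=> i _; rewrite big1 // => n _; rewrite big1 // => j _.
  by rewrite pM ?leq_addr // lie0l if_same.
apply: eq_bigr => i _; rewrite exchange_big lie_sumr big_split_ord /=.
rewrite [X in _ + X]big1 ?addr0; last first.
  by move=> j _; rewrite big1 // => n _; rewrite qM ?leq_addr // lie0r if_same.
apply: eq_bigr => j _.
have ij : (i + j < M0 + M0)%N by rewrite -addSn leq_add // ltnW.
rewrite (bigD1 (Ordinal ij)) //= eqxx big1 ?addr0 // => n.
by rewrite -val_eqE /= => /negPf->.
Qed.

Lemma teval_tmono n x : (0 < n)%N -> teval (tmono n x) = x.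
Proof.
move=> n0; rewrite (@tevalE n.+1); last by move=> k nk /=; rewrite gtn_eqF.
rewrite big_ord_recr /= eqxx n0 big1 ?add0r // => i _.
by rewrite ltn_eqF.
Qed.

End PolynomialLie.

Section TLift.
Variables (F : fieldType) (A : gradedLieType F) (M : lieType F) (f : A -> M).
Hypothesis fhom : lie_hom f.

Lemma lie_hom_linear_on : linear_on setT f.
Proof. by case: fhom => fl _ a x y _ _; apply: fl. Qed.

Fact tlift_subproof x : (fun n => f (hproj n x)) \in @tpoly_set F M.
Proof.
have f0 : f 0 = 0 := linear_on0 (subspaceT _) lie_hom_linear_on.
rewrite inE; split; first by rewrite hproj0E f0.
by have [N [_ x0 _]] := hproj_decomp x; exists N => n /x0->.
Qed.
(** An element with components x_n goes to the polynomial with coefficients f x_n. This is a graded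
    homomorphism although [f] is not graded, and its value at t = 1 is [f] again. *)
Definition tlift x : tpoly M := TPoly (tlift_subproof x).

Lemma tlift_graded_hom : graded_lie_hom tlift.
Proof.
have [fl fb] := fhom; have f0 : f 0 = 0 := linear_on0 (subspaceT _) lie_hom_linear_on.
split; first split.
- by move=> a x y; apply: tpoly_ext => n; rewrite tcoefD tcoefZ /= hproj_linear fl.
- move=> x y; apply: tpoly_ext => n; rewrite -[RHS]/(tconv (tcoef (tlift x)) (tcoef (tlift y)) n).
  rewrite /= hproj_lie (linear_on_sum (subspaceT _) lie_hom_linear_on) // /tconv.
  apply: eq_bigr => i _; have ni : (n - i < n.+1)%N by rewrite ltnS leq_subr.
  have iltn : (i <= n)%N by rewrite -ltnS.
  rewrite (bigD1 (Ordinal ni)) //= subnKC // eqxx big1 ?addr0 ?fb // => j.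
  rewrite -val_eqE /= => jn; case: eqP => // nE.
  by case/eqP: jn; apply: (@addnI i); rewrite subnKC.
- by move=> n x nx k /eqP/negPf kn /=; rewrite (hproj_hcomp _ nx) kn.
Qed.

Lemma teval_tlift x : teval (tlift x) = f x.
Proof.
have f0 : f 0 = 0 := linear_on0 (subspaceT _) lie_hom_linear_on.
have [N [_ x0 xs]] := hproj_decomp x.
rewrite (@tevalE _ _ N); last by move=> n /x0 /= ->.
by rewrite {2}(xs N) // (linear_on_sum (subspaceT _) lie_hom_linear_on).
Qed.
End TLift.

Lemma lie_hom_comp (F : fieldType) (A B C : lieType F) (g : B -> C) (f : A -> B) :
  lie_hom g -> lie_hom f -> lie_hom (g \o f).
Proof. by move=> [gl gb] [fl fb]; split=> [a x y|x y] /=; rewrite ?fl ?gl ?fb ?gb. Qed.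

(** The universal property is applied with target t M[t], to the lifts of f and g, and the result is
    evaluated at t = 1. *)
Lemma free_product_lift (F : fieldType) (A B L : gradedLieType F) (iA : A -> L)
    (iB : B -> L) (M : lieType F) (f : A -> M) (g : B -> M) :
    is_free_product iA iB -> lie_hom f -> lie_hom g ->
  exists h : L -> M, [/\ lie_hom h, forall x, h (iA x) = f x &
                         forall y, h (iB y) = g y].
Proof.
move=> [_ _ uP] fh gh.
have [h [[[hh _] hA hB] _]] := uP _ _ _ (tlift_graded_hom fh) (tlift_graded_hom gh).
exists (@teval F M \o h); split.
- by apply: lie_hom_comp hh; apply: teval_lie_hom.
- by move=> x; rewrite /= hA teval_tlift.
- by move=> x; rewrite /= hB teval_tlift.
Qed.

(** * Gluing modules over the factors *)

Lemma linear_maps_on (F : fieldType) (V V' : lmodType F) (f : V -> V') :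
  linear f -> linear_on setT f.
Proof. by move=> fl a x y _ _; apply: fl. Qed.

Section Swap.
Variables (F : fieldType) (I1 I2 Y : lmodType F).
Variables (e1 : I1 -> Y) (e2 : I2 -> Y) (s1 : Y -> I1) (s2 : Y -> I2) (T : Y -> Y).
Hypotheses (e1l : linear e1) (e2l : linear e2) (s1l : linear s1) (s2l : linear s2).
Hypotheses (Tl : linear T) (e1K : forall y, e1 (s1 y) = y).
Hypotheses (e2K : forall y, e2 (s2 y) = y) (TK : involutive T).

(** The sections split I1 as ker e1 + s1 Y and I2 as ker e2 + s2 Y. The map fixes both kernels and
    sends the Y-coordinates (y1, y2) to (y2, T y1). Working on the product avoids comparing the two
    kernels, which need not be isomorphic. *)
Definition swap (q : I1 * I2) : I1 * I2 :=
  (q.1 - s1 (e1 q.1) + s1 (e2 q.2), q.2 - s2 (e2 q.2) + s2 (T (e1 q.1))).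
Definition unswap (q : I1 * I2) : I1 * I2 :=
  (q.1 - s1 (e1 q.1) + s1 (T (e2 q.2)), q.2 - s2 (e2 q.2) + s2 (e1 q.1)).

Let affine (V : lmodType F) (a : F) (x x' y y' z z' : V) :
  a *: x + x' - (a *: y + y') + (a *: z + z') = a *: (x - y + z) + (x' - y' + z').
Proof. by rewrite !scalerDr scalerN opprD !addrA [LHS](ACl (1*3*5*2*4*6)). Qed.

Lemma swap_linear : linear swap.
Proof.
move=> a q r; rewrite /swap /= !(e1l, e2l, Tl, s1l, s2l) !affine.
by [].
Qed.

Lemma unswap_linear : linear unswap.
Proof.
move=> a q r; rewrite /unswap /= !(e1l, e2l, Tl, s1l, s2l) !affine.
by [].
Qed.

Let e1E x y : e1 (x - s1 (e1 x) + s1 y) = y.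
Proof.
have e1o := linear_maps_on e1l.
by rewrite (linear_onD e1o) // (linear_onB (subspaceT _) e1o) // !e1K subrr add0r.
Qed.
Let e2E x y : e2 (x - s2 (e2 x) + s2 y) = y.
Proof.
have e2o := linear_maps_on e2l.
by rewrite (linear_onD e2o) // (linear_onB (subspaceT _) e2o) // !e2K subrr add0r.
Qed.

Lemma unswapK q : swap (unswap q) = q.
Proof. by case: q => x y; rewrite /swap /unswap /= !e1E !e2E TK !addrK !subrK. Qed.

Lemma e2_swap q : e2 (swap q).2 = T (e1 q.1).
Proof. exact: e2E. Qed.
Lemma e1_unswap q : e1 (unswap q).1 = T (e2 q.2).
Proof. exact: e1E. Qed.
End Swap.

Section Glue.
Variables (F : fieldType) (A B L : gradedLieType F) (iA : A -> L) (iB : B -> L).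
Hypothesis L_AB : is_free_product iA iB.

Section Coordinates.
Variables (C : gradedLieType F) (C0 : set C) (Z : lmodType F).
Variables (rho0 : C -> Z -> Z) (J : set C) (d : seq C) (r : nat).
Hypotheses (sized : size d = r) (ext : extends_rep C0 rho0 J setT d).

(** The projection and the values along the r directions are collected into one map [e] with a
    linear section, the form in which the two factors can be compared. *)
Lemma extends_rep_coord :
  exists (I : lmodType F) (rho : C -> I -> I) (e : I -> Z * ('I_r -> Z))
         (s : Z * ('I_r -> Z) -> I),
  [/\ is_rep setT rho, linear e /\ linear s, forall y, e (s y) = y,
      forall x v, C0 x -> (e (rho x v)).1 = rho0 x (e v).1 &
      forall (k : 'I_r) v, (e (rho d`_k v)).1 = (e v).2 k].
Proof.
have [I [rho [pi [s [rr _ [pil pi0] sl sP]]]]] := ext.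
have [r1 r2 _] := rr.
exists I, rho, (fun v => (pi v, fun k : 'I_r => pi (rho d`_k v))).
(* The section takes a sequence indexed by all of nat; beyond r it is filled with 0. *)
exists (fun y => s y.1 (fun n => if insub n is Some i then y.2 i else 0)).
split=> //.
- split=> [a x y|a x y] /=.
    congr pair; first exact: pil.
    by apply/funext => k; rewrite r1 // pil.
  rewrite -sl; congr s; apply/funext => n.
  rewrite -[RHS]/(a *: (if insub n is Some i then x.2 i else 0)
    + (if insub n is Some i then y.2 i else 0)).
  by case: insubP => [i _ _|_] //; rewrite scaler0 addr0.
- move=> [z y] /=; have [piz pik] := sP z (fun n => if insub n is Some i then y i else 0).
  congr pair => //; apply/funext => k; rewrite pik ?sized //.
  by rewrite valK.
Qed.
End Coordinates.

(** In general neither a_k nor b_k preserves the kernel of p, since the value of p on a_k q is a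
    coordinate independent of p q. Only their sum descends to Z, where it acts as the prescribed
    operator [mu k]. *)
Lemma glue_reps (A0 : set A) (B0 : set B) (Z : lmodType F)
    (ra : A -> Z -> Z) (rb : B -> Z -> Z) (JA : set A) (JB : set B)
    (dA : seq A) (dB : seq B) (mu : nat -> Z -> Z) :
    size dB = size dA -> (forall k, linear (mu k)) ->
    extends_rep A0 ra JA setT dA -> extends_rep B0 rb JB setT dB ->
  exists (Q : lmodType F) (D : L -> lin_end Q) (p : Q -> Z),
  [/\ lie_hom D, linear p /\ (forall z, exists q, p q = z),
      forall x q, A0 x -> p (val (D (iA x)) q) = ra x (p q),
      forall x q, B0 x -> p (val (D (iB x)) q) = rb x (p q) &
      forall k q, (k < size dA)%N ->
        p (val (D (iA dA`_k + iB dB`_k)) q) = mu k (p q)].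
Proof.
move=> sz mul extA extB; set r := size dA in sz *.
have [I1 [rho1 [e1 [s1 [rr1 [e1l s1l] e1K e10 e1k]]]]] := extends_rep_coord (erefl r) extA.
have [I2 [rho2 [e2 [s2 [rr2 [e2l s2l] e2K e20 e2k]]]]] := extends_rep_coord sz extB.
pose T (y : Z * ('I_r -> Z)) : Z * ('I_r -> Z) := (y.1, fun k : 'I_r => mu k y.1 - y.2 k).
have Tl : linear T.
  move=> a x y; congr pair; apply/funext => k.
  rewrite -[LHS]/(mu k (a *: x.1 + y.1) - (a *: x.2 k + y.2 k)) mul.
  rewrite -[RHS]/(a *: (mu k x.1 - x.2 k) + (mu k y.1 - y.2 k)).
  by rewrite scalerBr opprD addrACA.
have TK : involutive T.
  by case=> z y; congr pair; apply/funext => k; rewrite /= subKr.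
pose tau := swap e1 e2 s1 s2 T; pose tauV := unswap e1 e2 s1 s2 T.
have taul : linear tau by apply: swap_linear.
have tauVl : linear tauV by apply: unswap_linear.
have tauK q : tau (tauV q) = q by apply: unswapK.
have [r11 r12 r13] := rr1; have [r21 r22 r23] := rr2.
have linA x : (fun q : I1 * I2 => (rho1 x q.1, 0 : I2)) \in [set f | linear f].
  rewrite inE => a q q'; rewrite -[RHS]/(a *: rho1 x q.1 + rho1 x q'.1, a *: 0 + 0).
  by rewrite scaler0 addr0 -r11.
have linB x : (fun q : I1 * I2 => tauV (0 : I1, rho2 x (tau q).2)) \in [set f | linear f].
  rewrite inE => a q q'; rewrite -tauVl taul.
  rewrite -[RHS]/(tauV (a *: 0 + 0, a *: rho2 x (tau q).2 + rho2 x (tau q').2)).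
  by rewrite scaler0 addr0 -r21.
pose DA x := LinEnd (linA x); pose DB x := LinEnd (linB x).
have DAh : lie_hom DA.
  split=> [a x y|x y]; apply/val_inj/funext => q.
    rewrite -[RHS]/(a *: rho1 x q.1 + rho1 y q.1, a *: 0 + 0).
    by rewrite scaler0 addr0 -(r12 q.1 a x y).
  rewrite -[RHS]/(rho1 x (rho1 y q.1) - rho1 y (rho1 x q.1), 0 - 0).
  by rewrite subr0 -r13.
have DBh : lie_hom DB.
  split=> [a x y|x y]; apply/val_inj/funext => q.
    rewrite -[RHS]/(a *: tauV (0, rho2 x (tau q).2) + tauV (0, rho2 y (tau q).2)).
    rewrite -tauVl -[RHS]/(tauV (a *: 0 + 0, a *: rho2 x (tau q).2 + rho2 y (tau q).2)).
    by rewrite scaler0 addr0 -(r22 (tau q).2 a x y).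
  rewrite -[RHS]/(tauV (0, rho2 x (tau (tauV (0, rho2 y (tau q).2))).2)
    - tauV (0, rho2 y (tau (tauV (0, rho2 x (tau q).2))).2)) !tauK /=.
  rewrite -(linear_onB (subspaceT _) (linear_maps_on tauVl)) //.
  rewrite -[RHS]/(tauV (0 - 0, rho2 x (rho2 y (tau q).2) - rho2 y (rho2 x (tau q).2))).
  by rewrite subr0 -r23.
have [D [Dh DiA DiB]] := free_product_lift L_AB DAh DBh.
(* [tauV] brings the coordinates of I2 into I1 through T, and T leaves the Z-coordinate unchanged.
   Hence p of an element acted on by B can be read in I2, where B acts by its own representation. *)
have pB x q : (e1 (val (DB x) q).1).1 = (e2 (rho2 x (tau q).2)).1.
  rewrite -[LHS]/((e1 (tauV (0, rho2 x (tau q).2)).1).1).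
  by rewrite /tauV e1_unswap.
exists (I1 * I2)%type, D, (fun q => (e1 q.1).1); split=> //.
- split=> [a x y|z]; first by rewrite [(_ *: _ + _).1]/= e1l.
  by exists (s1 (z, 0), 0); rewrite e1K.
- by move=> x q A0x; rewrite DiA; apply: e10.
- by move=> x q B0x; rewrite DiB pB e20 // e2_swap.
- move=> k q kr.
  have -> : D (iA dA`_k + iB dB`_k) = DA dA`_k + DB dB`_k.
    by rewrite (linear_onD (lie_hom_linear_on Dh)) // DiA DiB.
  rewrite -[val _ q]/(val (DA dA`_k) q + val (DB dB`_k) q).
  rewrite -[(_ + _).1]/((val (DA dA`_k) q).1 + (val (DB dB`_k) q).1).
  rewrite (linear_onD (linear_maps_on e1l)) // -[(_ + _).1]/(_.1 + _.1) pB.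
  rewrite (e2k (Ordinal kr)) e2_swap //= (e1k (Ordinal kr)) /=.
  by rewrite addrC subrK.
Qed.
End Glue.

(** * Graded homomorphisms on subalgebras *)

Section LieSpan.
Variables (F : fieldType) (L : lieType F).
Implicit Types S T : set L.

Lemma lie_span_subspace S : subspace (lie_span S).
Proof. by split=> [|a x y]; [apply: lie_span0 | apply: lie_span_linear]. Qed.

Lemma lie_span_min S T : subspace T -> lie_closed T -> S `<=` T -> lie_span S `<=` T.
Proof.
move=> [T0 Tl] lT ST x; elim=> {x} [x /ST //|//|a x y _ Tx _ Ty|x y _ Tx _ Ty].
  exact: Tl.
exact: lT.
Qed.
End LieSpan.

Lemma lie_span_hproj_closed (F : fieldType) (L : gradedLieType F) (S : set L) n x :
  S `<=` hcomp 1 -> lie_span S x -> lie_span S (hproj n x).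
Proof.
move=> S1 Sx; elim: Sx n => {x} [x Sx||a x y _ IHx _ IHy|x y _ IHx _ IHy] n.
- rewrite (hproj_hcomp n (S1 _ Sx)); case: eqP => _; last exact: lie_span0.
  exact: lie_span_gen.
- by rewrite hproj0; apply: lie_span0.
- by rewrite hproj_linear; apply: lie_span_linear.
- rewrite hproj_lie; apply: subspace_sum; first exact: lie_span_subspace.
  by move=> i _; apply: lie_span_lie.
Qed.

Lemma lie_span_hproj1 (F : fieldType) (L : gradedLieType F) (S W : set L) x :
    S `<=` hcomp 1 -> subspace W -> S `<=` W ->
  lie_span S x -> W (hproj 1 x).
Proof.
move=> S1 sW SW; apply: lie_span_hproj => // i u v /andP[i0].
by rewrite ltnNge i0.
Qed.

Lemma free_mod_map (F : fieldType) (V V' : lmodType F) (f : V -> V') (U : set V)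
    (U' : set V') e :
    linear f -> subspace U ->
    (forall x, add_span U e x -> U' (f x) -> U x) ->
  free_mod U e -> free_mod U' (map f e).
Proof.
move=> fl; elim: e U U' => [//|x e IHe] U U' sU UU' /= [Ux fe].
have sUx := add_line_subspace x sU; have sS := add_span_subspace e sUx.
have Sx : add_span (add_line U x) e x by apply: sub_add_span; apply: mem_add_line.
have flo := linear_maps_on fl.
split; first by move/(UU' x Sx).
apply: IHe fe => // y Sy [c Uy _]; exists c => //.
apply: UU'; last by rewrite (linear_onB (subspaceT _) flo) // (linear_onZ (subspaceT _) flo).
by apply: (subspaceB sS) => //; apply: subspaceZ.
Qed.

(** Maps on a subalgebra are carried as total maps on [L], constrained on [K] only. This keeps H,
    the span of H1 /\ A and the span of H1 /\ B inside one type until the end. *)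
Definition graded_hom_on (F : fieldType) (L M : gradedLieType F) (K : set L)
    (f : L -> M) : Prop :=
  [/\ linear_on K f, forall x y, K x -> K y -> f (lie x y) = lie (f x) (f y) &
      forall n x, K x -> hcomp n x -> hcomp n (f x)].

Lemma hproj_hom_on (F : fieldType) (L M : gradedLieType F) (K : set L)
    (f : L -> M) n x :
    subspace K -> (forall n x, K x -> K (hproj n x)) -> graded_hom_on K f ->
  K x -> hproj n (f x) = f (hproj n x).
Proof.
move=> sK Kh [fl _ fd] Kx; have [N [_ x0 xs]] := hproj_decomp x.
have f0 : f 0 = 0 := linear_on0 sK fl.
apply: (@decomp_uniq _ _ _ (fun n => f (hproj n x)) N); split.
- by move=> k; apply: fd; [apply: Kh | apply: hcomp_hproj].
- by move=> k Nk; rewrite x0.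
- move=> k Nk; rewrite {1}(xs k Nk).
  by rewrite (linear_on_sum sK fl) // => i _; apply: Kh.
Qed.

Section FreeProductBasics.
Variables (F : fieldType) (A B L : gradedLieType F) (iA : A -> L) (iB : B -> L).
Hypothesis L_AB : is_free_product iA iB.

Lemma graded_lie_hom_id (C : gradedLieType F) : graded_lie_hom (@id C).
Proof. by []. Qed.

Lemma graded_lie_hom0 (C C' : gradedLieType F) :
  graded_lie_hom (fun _ : C => 0 : C').
Proof.
split; first by split=> [a x y|x y]; rewrite ?scaler0 ?addr0 ?lie0l.
by move=> n x _; case: (hcomp_subspace C' n).
Qed.

Lemma free_product_retractl : exists r : L -> A,
  [/\ graded_lie_hom r, forall x, r (iA x) = x & forall y, r (iB y) = 0].
Proof.
have [_ _ uP] := L_AB.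
by have [r [rP _]] := uP _ _ _ (@graded_lie_hom_id A) (@graded_lie_hom0 B A); exists r.
Qed.

Lemma free_product_sym : is_free_product iB iA.
Proof.
have [hA hB uP] := L_AB; split=> // M f g fh gh.
have [h [[hh hf hg] hu]] := uP M g f gh fh.
by exists h; split=> [|h' [h'h h'f h'g]]; [split | apply: hu].
Qed.

(** Let K be the subalgebra generated by W = iA A_1 + iB B_1. It contains the images of [A] and [B],
    since these are generated in degree 1, so there is a homomorphism from [L] to K over them. Its
    composite with the inclusion is the identity by uniqueness, hence K = L, and the degree-1 part
    of K is W. *)
Lemma free_product_deg1 x : one_generated A -> one_generated B -> hcomp 1 x ->
  exists a b, [/\ hcomp 1 a, hcomp 1 b & x = iA a + iB b].
Proof.
move=> gA gB; have [[[iAl iAb] iAd] [[iBl iBb] iBd] uP] := L_AB.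
pose W : set L := [set x | exists a b, [/\ hcomp 1 a, hcomp 1 b & x = iA a + iB b]].
have iA0 : iA 0 = 0 := linear_on0 (subspaceT _) (linear_maps_on iAl).
have iB0 : iB 0 = 0 := linear_on0 (subspaceT _) (linear_maps_on iBl).
have [A0 Al] := hcomp_subspace A 1; have [B0 Bl] := hcomp_subspace B 1.
have sW : subspace W.
  split; first by exists 0, 0; rewrite iA0 iB0 addr0.
  move=> c _ _ [a [b [a1 b1 ->]]] [a' [b' [a1' b1' ->]]].
  exists (c *: a + a'), (c *: b + b').
  split; [exact: Al|exact: Bl|by rewrite iAl iBl scalerDr addrACA].
have W1 : W `<=` hcomp 1.
  by move=> _ [a [b [/iAd a1 /iBd b1 ->]]]; apply: (subspaceD (hcomp_subspace L 1)).
pose K := gen1 W.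
have memA a : iA a \in sub_set K.
  rewrite inE; elim: (gA a) => {a} [a a1||c u v _ IHx _ IHy|u v _ IHx _ IHy].
  - apply: lie_span_gen; split; last exact: iAd.
    by exists a, 0; rewrite iB0 addr0.
  - by rewrite iA0; apply: lie_span0.
  - by rewrite iAl; apply: lie_span_linear.
  - by rewrite iAb; apply: lie_span_lie.
have memB b : iB b \in sub_set K.
  rewrite inE; elim: (gB b) => {b} [b b1||c u v _ IHx _ IHy|u v _ IHx _ IHy].
  - apply: lie_span_gen; split; last exact: iBd.
    by exists 0, b; rewrite iA0 add0r.
  - by rewrite iB0; apply: lie_span0.
  - by rewrite iBl; apply: lie_span_linear.
  - by rewrite iBb; apply: lie_span_lie.
pose fA a : sub_algebra K := SubElt (memA a).
pose fB b : sub_algebra K := SubElt (memB b).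
have fAh : graded_lie_hom fA.
  split=> [|n a an]; last exact: iAd.
  by split=> [c a a'|a a']; apply: val_inj; rewrite /= ?iAl ?iAb.
have fBh : graded_lie_hom fB.
  split=> [|n a an]; last exact: iBd.
  by split=> [c a a'|a a']; apply: val_inj; rewrite /= ?iBl ?iBb.
have [h [[[[hl hb] hd] hA hB] _]] := uP _ _ _ fAh fBh.
have [k [_ ku]] := uP L iA iB (conj (conj iAl iAb) iAd) (conj (conj iBl iBb) iBd).
have /(congr1 (fun f : L -> L => f x)) /= <- : k = id by apply: ku; split=> //; apply: graded_lie_hom_id.
have -> : k = val \o h.
  apply: ku; split=> [|a|b] /=; last 2 first.
  - by rewrite hA.
  - by rewrite hB.
  split=> [|n y /hd //]; split=> [c y z|y z] /=; first by rewrite hl.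
  by rewrite hb.
move=> x1; rewrite -(hproj_id x1).
apply: (@lie_span_hproj1 _ _ (W `&` hcomp 1) W) => //.
by have := valP (h x); rewrite inE.
Qed.
End FreeProductBasics.

(** * Extending homomorphisms to H *)

(** Generation inside the ambient algebra is replayed inside the subalgebra taken as a type of its
    own, which gives an induction principle for its elements. *)
Lemma gen1_lie_span (F : fieldType) (L : gradedLieType F) (T : set L)
    (x : sub_algebra (gen1 T)) :
  lie_span [set y : sub_algebra (gen1 T) | T (val y) /\ hcomp 1 (val y)] x.
Proof.
pose X := [set y : sub_algebra (gen1 T) | T (val y) /\ hcomp 1 (val y)].
suff gen y : lie_span (T `&` hcomp 1) y ->
    forall yK : y \in sub_set (gen1 T), lie_span X (SubElt yK).
  case: x => y yK; apply: gen; exact: set_mem yK.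
elim=> {y} [y [Ty y1]||c y z Ky IHy Kz IHz|y z Ky IHy Kz IHz] K.
- by apply: lie_span_gen.
- have -> : SubElt K = 0 by apply: val_inj.
  exact: lie_span0.
- have -> : SubElt K = c *: SubElt (mem_set Ky : y \in sub_set (gen1 T))
      + SubElt (mem_set Kz : z \in sub_set (gen1 T)) by apply: val_inj.
  exact: lie_span_linear.
- have -> : SubElt K = lie (SubElt (mem_set Ky : y \in sub_set (gen1 T)))
      (SubElt (mem_set Kz : z \in sub_set (gen1 T))) by apply: val_inj.
  exact: lie_span_lie.
Qed.

Lemma add_span_preimage (F : fieldType) (V V' : lmodType F) (f : V -> V')
    (U : set V') e x :
  linear f -> add_span U (map f e) (f x) -> add_span (f @^-1` U) e x.
Proof.
move=> fl; have flo := linear_maps_on fl.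
elim: e U => [//|y e IHe] U /= /IHe; congr (add_span _ e x).
apply/seteqP; split=> z [c /= Uz _]; exists c => //; move: Uz; rewrite /=;
  by rewrite (linear_onB (subspaceT _) flo) ?(linear_onZ (subspaceT _) flo).
Qed.

Lemma gen1_locally_finite (F : fieldType) (M : gradedLieType F) (l : seq M) :
    (forall y, y \in l -> hcomp 1 y) ->
  locally_finite (sub_algebra (gen1 [set y | y \in l])).
Proof.
move=> l1; set K := gen1 _; apply: one_generated_locally_finite.
  move=> x; apply: (lie_span_min _ _ _ (gen1_lie_span x)).
  - exact: lie_span_subspace.
  - exact: lie_span_lie.
  - by move=> y [_ y1]; apply: lie_span_gen.
have lK y : y \in l -> y \in sub_set K.
  by move=> yl; rewrite inE; apply: lie_span_gen; split=> //; apply: l1.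
have [l' l'E] : exists l' : seq (sub_algebra K), map val l' = l.
  elim: (l) lK => [|y e IHe] eK; first by exists [::].
  have [|l' l'E] := IHe; first by move=> z ze; apply: eK; rewrite inE ze orbT.
  by exists (SubElt (eK y (mem_head _ _)) :: l'); rewrite /= l'E.
exists l' => x x1; have x1' : hcomp 1 (val x) by [].
have -> : [set 0] = val @^-1` [set 0] :> set (sub_algebra K).
  apply/seteqP; split=> y /=; first by move=> ->.
  by move=> y0; apply: val_inj.
apply: add_span_preimage => //; rewrite l'E -(hproj_id x1').
apply: (@lie_span_hproj1 _ _ ([set y | y \in l] `&` hcomp 1)).
- by move=> y [].
- exact/add_span_subspace/subspace0.
- by move=> y [yl _]; apply: mem_add_span => //; apply: subspace0.
- exact: set_mem (valP x).
Qed.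

Section Directions.
Variables (F : fieldType) (C L M : gradedLieType F) (iC : C -> L) (rC : L -> C).
Variables (HC : set L) (w : seq L) (g : L -> M).
Hypotheses (lfC : locally_finite C) (iCh : graded_lie_hom iC) (rCh : graded_lie_hom rC).
Hypotheses (sHC : subspace HC) (HC1 : HC `<=` hcomp 1).
Hypotheses (w1 : forall x, x \in w -> hcomp 1 x) (fw : free_mod [set 0] w).
Hypothesis wC : forall x, add_span [set 0] w x -> HC (iC (rC x)) -> x = 0.
Hypothesis gh : graded_hom_on (lie_span HC) g.
Variables (Z : lmodType F) (rho : M -> Z -> Z) (N : nat).
Hypotheses (rr : is_rep setT rho) (rN : forall x v, hideal N.+1 x -> rho x v = 0).

(** The directions have degree 1, hence belong to layer 0, and [N.+1] guarantees that this layer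
    lies above the annihilating ideal. [g] is graded, so it maps elements of high degree to elements
    acting as 0. *)
Lemma extends_rep_directions :
  extends_rep [set a | lie_span HC (iC a)] (fun a => rho (g (iC a)))
    (hideal N.+1) setT (map rC w).
Proof.
have [[iCl iCb] iCd] := iCh; have [[rCl rCb] rCd] := rCh.
have iC0 : iC 0 = 0 := linear_on0 (subspaceT _) (linear_maps_on iCl).
have sK := lie_span_subspace HC.
have [r1 r2 r3] := rr; have [gl gb gd] := gh.
have Kh n x : lie_span HC x -> lie_span HC (hproj n x) by apply: lie_span_hproj_closed.
have sC0 : subspace [set a | lie_span HC (iC a)].
  by split=> [|a x y] /=; rewrite ?iC0 ?iCl; [apply: lie_span0 | apply: lie_span_linear].
apply: (@extends_rep_graded _ _ _ sC0 _ lfC _ _ N.+1 _ _ 0) => //.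
- by move=> x y /=; rewrite iCb; apply: lie_span_lie.
- split=> [x Kx|z a x y Kx Ky|x y z Kx Ky].
  + exact: r1.
  + by rewrite iCl gl // (r2 z a).
  + by rewrite iCb gb // r3.
- move=> x v Kx Nx; apply: rN => k kN.
  by rewrite (hproj_hom_on _ sK Kh gh) // (hproj_hom _ _ iCh) Nx // iC0 (linear_on0 sK gl).
- by move=> x _; rewrite add_hideal0.
apply: free_mod_map fw => //; first exact: subspace0.
(* If rC x agrees with some a modulo degrees above 1, then iC (rC x) is the degree-1 component of iC
   a, an element of the span of [HC]; so it lies in [HC] itself. *)
move=> x wx [a /= Ka Ja]; apply: wC => //.
have x1 : hcomp 1 x.
  apply: (add_span_min (hcomp_subspace L 1)) wx => // y ->.
  by case: (hcomp_subspace L 1).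
have : HC (hproj 1 (iC a)) by apply: lie_span_hproj1 Ka.
rewrite (hproj_hom _ _ iCh); suff -> : hproj 1 a = rC x by [].
have := Ja 1%N isT; rewrite hprojB (hproj_id (rCd _ _ x1)) => /eqP.
by rewrite subr_eq0 => /eqP.
Qed.
End Directions.

(** * The homomorphism with prescribed values on W, H1 /\ A and H1 /\ B *)

Section Kurosh.
Variables (F : fieldType) (A B L : gradedLieType F) (iA : A -> L) (iB : B -> L).
Hypotheses (L_AB : is_free_product iA iB) (lfA : locally_finite A) (lfB : locally_finite B).
Variables (W HA HB : set L) (w : seq L).
Hypotheses (WE : add_span [set 0] w = W) (fw : free_mod [set 0] w).
Hypotheses (W1 : W `<=` hcomp 1).
Hypotheses (sHA : subspace HA) (HA1 : HA `<=` hcomp 1) (HAi : HA `<=` range iA).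
Hypotheses (sHB : subspace HB) (HB1 : HB `<=` hcomp 1) (HBi : HB `<=` range iB).
Hypothesis WAB : forall x, W x -> exists a b, x = iA a + iB b.
Hypothesis WA : forall a b, W (iA a + iB b) -> HA (iA a) -> iA a + iB b = 0.
Hypothesis WB : forall a b, W (iA a + iB b) -> HB (iB b) -> iA a + iB b = 0.
Variable H1 : set L.
Hypothesis H1E : forall x, H1 x -> exists x1 x2 x3, [/\ W x1, HA x2, HB x3 & x = x1 + x2 + x3].
Hypotheses (WH : W `<=` H1) (HAH : HA `<=` H1) (HBH : HB `<=` H1).

Section Target.
Variable M : gradedLieType F.
Variables (f g h : L -> M).
Hypotheses (fl : linear_on W f) (f1 : forall x, W x -> hcomp 1 (f x)).
Hypotheses (gh : graded_hom_on (lie_span HA) g) (hh : graded_hom_on (lie_span HB) h).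

(* [compatible rho D p]: through the surjection p : Q -> Z, the elements of H1
   act on the L-module Q as their prescribed images in M act on Z. *)
Definition compatible (Z Q : lmodType F) (rho : M -> Z -> Z) (D : L -> lin_end Q)
    (p : Q -> Z) : Prop :=
  [/\ lie_hom D, linear p /\ (forall z, exists q, p q = z),
      forall x q, W x -> p (val (D x) q) = rho (f x) (p q),
      forall x q, HA x -> p (val (D x) q) = rho (g x) (p q) &
      forall x q, HB x -> p (val (D x) q) = rho (h x) (p q)].

Lemma exists_compatible (Z : lmodType F) (rho : M -> Z -> Z) N :
    is_rep setT rho -> (forall x v, hideal N x -> rho x v = 0) ->
  exists (Q : lmodType F) (D : L -> lin_end Q) (p : Q -> Z), compatible rho D p.
Proof.
move=> rr rN; have [r1 r2 r3] := rr.
have [iAh iBh _] := L_AB; have [[iAl _] _] := iAh; have [[iBl _] _] := iBh.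
have [rA [rAh rAA rAB]] := free_product_retractl L_AB.
have [rB [rBh rBB rBA]] := free_product_retractl (free_product_sym L_AB).
have rAE a b : rA (iA a + iB b) = a.
  by rewrite (linear_onD (lie_hom_linear_on rAh.1)) // rAA rAB addr0.
have rBE a b : rB (iA a + iB b) = b.
  by rewrite (linear_onD (lie_hom_linear_on rBh.1)) // rBB rBA add0r.
have wW x : x \in w -> W x.
  by rewrite -WE; apply: mem_add_span; apply: subspace0.
have w1 x : x \in w -> hcomp 1 x by move=> /wW/W1.
(* The level is raised by one so that layer 0 is available even when N = 0. *)
have rN' x v : hideal N.+1 x -> rho x v = 0 by move=> /hidealS/rN.
have extA : extends_rep [set a | lie_span HA (iA a)] (fun a => rho (g (iA a)))
    (hideal N.+1) setT (map rA w).
  apply: (extends_rep_directions lfA iAh rAh sHA HA1 w1 fw _ gh rr rN') => x.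
  rewrite WE => Wx; have [a [b xE]] := WAB Wx; move: Wx; rewrite xE rAE => Wx; exact: WA Wx.
have extB : extends_rep [set b | lie_span HB (iB b)] (fun b => rho (h (iB b)))
    (hideal N.+1) setT (map rB w).
  apply: (extends_rep_directions lfB iBh rBh sHB HB1 w1 fw _ hh rr rN') => x.
  rewrite WE => Wx; have [a [b xE]] := WAB Wx; move: Wx; rewrite xE rBE => Wx; exact: WB Wx.
have mul k : linear (rho (f w`_k)) by apply: r1.
have [|Q [D [p [Dh [pl ps] pA pB pw]]]] := glue_reps L_AB _ mul extA extB.
  by rewrite !size_map.
have plo := linear_maps_on pl; have Dlo := lie_hom_linear_on Dh.
exists Q, D, p; split=> //.
- have sW : subspace W by rewrite -WE; apply/add_span_subspace/subspace0.
  suff Ww : W `<=` [set x | W x /\ forall q, p (val (D x) q) = rho (f x) (p q)].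
    by move=> x q /Ww[_].
  rewrite -{1}WE; apply: add_span_min.
  + split.
      split=> [|q]; first by case: sW.
      rewrite (linear_on0 sW fl) (linear_on0 (subspaceT _) (r2 (p q))).
      by rewrite (linear_on0 (subspaceT _) Dlo) (linear_on0 (subspaceT _) plo).
    move=> c x y [Wx px] [Wy py]; split; first by case: sW => _; apply.
    move=> q; rewrite Dlo // fl // (r2 (p q) c) // -px -py -pl.
    by [].
  + move=> x ->; split=> [|q]; first by case: sW.
    rewrite (linear_on0 sW fl) (linear_on0 (subspaceT _) (r2 (p q))).
    by rewrite (linear_on0 (subspaceT _) Dlo) (linear_on0 (subspaceT _) plo).
  + move=> x xw; split=> [|q]; first exact: wW.
    have kw : (index x w < size w)%N by rewrite index_mem.
    have := pw (index x w) q; rewrite size_map => /(_ kw).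
    rewrite !(nth_map 0) // nth_index //.
    by have [a [b ->]] := WAB (wW x xw); rewrite rAE rBE.
- by move=> x q HAx; have [a _ xE] := HAi HAx; rewrite -xE pA //= xE; apply: lie_span_gen.
- by move=> x q HBx; have [b _ xE] := HBi HBx; rewrite -xE pB //= xE; apply: lie_span_gen.
Qed.

(** The graph of the homomorphism to be built, tested on all nilpotent representations and all
    compatible modules at once. In this form it is closed under linear combinations and brackets
    with no reference to the way x is written in terms of generators. *)
Definition is_image (x : L) (m : M) : Prop :=
  forall N (Z : lmodType F) (rho : M -> Z -> Z), is_rep setT rho ->
    (forall x v, hideal N x -> rho x v = 0) ->
  forall (Q : lmodType F) (D : L -> lin_end Q) (p : Q -> Z), compatible rho D p ->
  forall q, p (val (D x) q) = rho m (p q).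

Lemma is_image_linear c x y m n :
  is_image x m -> is_image y n -> is_image (c *: x + y) (c *: m + n).
Proof.
move=> xm yn N Z rho rr rN Q D p co q; have [Dh [pl _] _ _ _] := co.
have [_ r2 _] := rr; rewrite (lie_hom_linear_on Dh) // (r2 (p q) c) //.
by rewrite -(xm _ _ _ rr rN _ _ _ co) -(yn _ _ _ rr rN _ _ _ co) -pl.
Qed.

Lemma is_image_lie x y m n :
  is_image x m -> is_image y n -> is_image (lie x y) (lie m n).
Proof.
move=> xm yn N Z rho rr rN Q D p co q; have [[_ Db] [pl _] _ _ _] := co.
have [_ _ r3] := rr; rewrite Db lin_end_lieE r3 //.
rewrite (linear_onB (subspaceT _) (linear_maps_on pl)) //.
by rewrite !(xm _ _ _ rr rN _ _ _ co, yn _ _ _ rr rN _ _ _ co).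
Qed.

Lemma is_image0 : is_image 0 0.
Proof.
move=> N Z rho rr rN Q D p [Dh [pl _] _ _ _] q; have [_ r2 _] := rr.
rewrite (linear_on0 (subspaceT _) (r2 (p q))).
rewrite (linear_on0 (subspaceT _) (lie_hom_linear_on Dh)).
by rewrite (linear_on0 (subspaceT _) (linear_maps_on pl)).
Qed.

(** By linearity m - n is an image of 0. Were it nonzero, some nilpotent Z would detect it; but 0
    acts as 0 on a compatible module Q, which maps onto Z. *)
Lemma is_image_uniq x m n : locally_finite M -> is_image x m -> is_image x n -> m = n.
Proof.
move=> lfM xm xn; apply/eqP; rewrite -subr_eq0; apply: contrapT => /negP mn0.
have := is_image_linear (-1) xn xm; rewrite !scaleN1r addNr addrC => im0.
have [N [Z [rho [rr rN [z rz]]]]] := exists_rep_neq0 lfM mn0.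
have [Q [D [p co]]] := exists_compatible rr rN.
have [Dh [pl ps] _ _ _] := co; have [q qz] := ps z.
case/eqP: rz; rewrite -qz -(im0 _ _ _ rr rN _ _ _ co).
rewrite (linear_on0 (subspaceT _) (lie_hom_linear_on Dh)).
by rewrite (linear_on0 (subspaceT _) (linear_maps_on pl)).
Qed.

Lemma exists_image x : lie_span H1 x -> exists m, is_image x m.
Proof.
have lin c y z : (exists m, is_image y m) -> (exists m, is_image z m) ->
    exists m, is_image (c *: y + z) m.
  by move=> [m ym] [n zn]; exists (c *: m + n); apply: is_image_linear.
elim=> {x} [x /H1E[x1 [x2 [x3 [Wx1 Ax2 Bx3 ->]]]]||c x y _ IHx _ IHy|].
- rewrite -[x1 + x2]scale1r; apply: (lin); last first.
    by exists (h x3) => N Z rho _ _ Q D p [_ _ _ _ pB] q; apply: pB.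
  rewrite -[x1]scale1r; apply: (lin).
    by exists (f x1) => N Z rho _ _ Q D p [_ _ pW _ _] q; apply: pW.
  by exists (g x2) => N Z rho _ _ Q D p [_ _ _ pA _] q; apply: pA.
- by exists 0; apply: is_image0.
- exact: lin.
- by move=> x y _ [m xm] _ [n yn]; exists (lie m n); apply: is_image_lie.
Qed.

Lemma exists_extension_lf : locally_finite M -> exists theta : L -> M,
  [/\ graded_hom_on (lie_span H1) theta, forall x, W x -> theta x = f x,
      forall x, HA x -> theta x = g x & forall x, HB x -> theta x = h x].
Proof.
move=> lfM; pose theta x := xget 0 [set m | is_image x m].
have thP x : lie_span H1 x -> is_image x (theta x).
  move=> /exists_image[m xm]; rewrite /theta; case: xgetP => // /(_ m); exact.
have thE x m : is_image x m -> theta x = m.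
  move=> xm; rewrite /theta; case: xgetP => [n _ xn|/(_ m)//].
  exact: is_image_uniq xn xm.
have thW x : W x -> theta x = f x.
  by move=> Wx; apply: thE => N Z rho _ _ Q D p [_ _ pW _ _] q; apply: pW.
have thA x : HA x -> theta x = g x.
  by move=> Ax; apply: thE => N Z rho _ _ Q D p [_ _ _ pA _] q; apply: pA.
have thB x : HB x -> theta x = h x.
  by move=> Bx; apply: thE => N Z rho _ _ Q D p [_ _ _ _ pB] q; apply: pB.
have thl : linear_on (lie_span H1) theta.
  by move=> c x y Hx Hy; apply/thE/is_image_linear; apply: thP.
have thb x y : lie_span H1 x -> lie_span H1 y ->
    theta (lie x y) = lie (theta x) (theta y).
  by move=> Hx Hy; apply/thE/is_image_lie; apply: thP.
have H11 : H1 `<=` hcomp 1.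
  move=> _ /H1E[x1 [x2 [x3 [/W1 ? /HA1 ? /HB1 ? ->]]]].
  by do 2!apply: (subspaceD (hcomp_subspace L 1)) => //.
have sH := lie_span_subspace H1.
have Hh n x : lie_span H1 x -> lie_span H1 (hproj n x) by apply: lie_span_hproj_closed.
have th0 : theta 0 = 0 := linear_on0 sH thl.
exists theta; split=> //; split=> //.
(* The representations do not see degrees, so gradedness is proved separately: [theta] commutes with
   the homogeneous projections, by induction from the generators, which have degree 1 on both
   sides. *)
suff thh x : lie_span H1 x -> forall n, theta (hproj n x) = hproj n (theta x).
  by move=> n x Hx /hproj_id nx; rewrite -nx thh //; apply: hcomp_hproj.
elim=> {x} [x Hx||c x y Hx IHx Hy IHy|x y Hx IHx Hy IHy] n.
- have th1 : hcomp 1 (theta x).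
    have [x1 [x2 [x3 [Wx1 Ax2 Bx3 ->]]]] := H1E Hx.
    have [_ _ gd] := gh; have [_ _ hd] := hh.
    have G y : H1 y -> lie_span H1 y by apply: lie_span_gen.
    have [Hx1 Hx2] := (G _ (WH Wx1), G _ (HAH Ax2)); have Hx3 := G _ (HBH Bx3).
    rewrite (linear_onD thl (subspaceD sH Hx1 Hx2) Hx3) (linear_onD thl Hx1 Hx2).
    rewrite thW // thA // thB //.
    have s1 := hcomp_subspace M 1.
    apply: (subspaceD s1); first apply: (subspaceD s1); first exact: f1.
      by apply: gd; [apply: lie_span_gen | apply: HA1].
    by apply: hd; [apply: lie_span_gen | apply: HB1].
  by rewrite (hproj_hcomp n (H11 _ Hx)) (hproj_hcomp n th1); case: eqP.
- by rewrite th0 !hproj0.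
- by rewrite hproj_linear !thl ?hproj_linear ?IHx ?IHy //; apply: Hh.
- rewrite hproj_lie thb // hproj_lie (linear_on_sum sH thl).
    by apply: eq_bigr => i _; rewrite thb ?IHx ?IHy //; apply: Hh.
  by move=> i _; apply: lie_span_lie; apply: Hh.
Qed.
End Target.

Hypothesis finL : fin_spanned (hcomp 1 : set L).

Lemma exists_extension (M : gradedLieType F) (f g h : L -> M) :
    linear_on W f -> (forall x, W x -> hcomp 1 (f x)) ->
    graded_hom_on (lie_span HA) g -> graded_hom_on (lie_span HB) h ->
  exists theta : L -> M,
  [/\ graded_hom_on (lie_span H1) theta, forall x, W x -> theta x = f x,
      forall x, HA x -> theta x = g x & forall x, HB x -> theta x = h x].
Proof.
move=> fl f1 [gl gb gd] [hl hb hd]; have [e eL] := finL.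
have basis (U : set L) : subspace U -> U `<=` hcomp 1 ->
    exists2 u, forall x, x \in u -> U x & add_span [set 0] u = U.
  move=> sU U1; have [||||u [_ uU] uE] := @exists_free_mod _ _ [set 0] U e.
  - exact: subspace0.
  - exact: sU.
  - by move=> x ->; case: sU.
  - by move=> x /U1/eL.
  - by exists u.
have [uA uAH uAE] := basis _ sHA HA1; have [uB uBH uBE] := basis _ sHB HB1.
have wW x : x \in w -> W x by rewrite -WE; apply: mem_add_span; apply: subspace0.
pose l := map f w ++ map g uA ++ map h uB.
have l1 y : y \in l -> hcomp 1 y.
  rewrite !mem_cat => /or3P[] /mapP[x xu ->].
  - exact/f1/wW.
  - by apply: gd; [apply/lie_span_gen/uAH | apply/HA1/uAH].
  - by apply: hd; [apply/lie_span_gen/uBH | apply/HB1/uBH].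
pose K := gen1 [set y | y \in l]; pose M' := sub_algebra K.
have lfM' : locally_finite M' by apply: gen1_locally_finite.
have lK y : y \in l -> sub_set K y by move=> yl; apply: lie_span_gen; split=> //; apply: l1.
have sK := sub_subspace K.
have spanK (U : set L) (u : seq L) (k : L -> M) : add_span [set 0] u = U ->
    linear_on U k -> (forall x, x \in u -> sub_set K (k x)) ->
    forall x, U x -> sub_set K (k x).
  move=> <- kl uK; apply: linear_on_add_span => //; first exact: subspace0.
  move=> x ->; rewrite (linear_on0 _ kl); first by case: sK.
  exact/add_span_subspace/subspace0.
have fK : forall x, W x -> sub_set K (f x).
  apply: spanK WE fl _ => x xw; apply: lK.
  by rewrite !mem_cat map_f.
have sub1 (U : set L) : U `<=` lie_span U by move=> x; apply: lie_span_gen.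
have spanK' (U : set L) (k : L -> M) : linear_on (lie_span U) k ->
    (forall x y, lie_span U x -> lie_span U y -> k (lie x y) = lie (k x) (k y)) ->
    (forall x, U x -> sub_set K (k x)) -> forall x, lie_span U x -> sub_set K (k x).
  move=> kl kb kU x; elim=> {x} [x /kU//||c x y Ux IHx Uy IHy|x y Ux IHx Uy IHy].
  - by rewrite (linear_on0 (lie_span_subspace U) kl); case: sK.
  - by rewrite kl //; case: sK => _; apply.
  - by rewrite kb //; apply: sub_lie.
have gK : forall x, lie_span HA x -> sub_set K (g x).
  apply: spanK' => //; apply: spanK uAE _ _ => [c x y /sub1 ? /sub1 ?|x xu].
    exact: gl.
  by apply: lK; rewrite !mem_cat map_f ?orbT.
have hK : forall x, lie_span HB x -> sub_set K (h x).
  apply: spanK' => //; apply: spanK uBE _ _ => [c x y /sub1 ? /sub1 ?|x xu].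
    exact: hl.
  by apply: lK; rewrite !mem_cat map_f ?orbT.
(* Corestriction to the finitely generated subalgebra [M']; the default 0 is taken only where the
   value is outside it. *)
pose down (k : L -> M) : L -> M' := fun x => insubd (0 : M') (k x).
have downE (k : L -> M) x : sub_set K (k x) -> val (down k x) = k x.
  by move=> Kx; rewrite /down val_insubd mem_set.
have down_lin (U : set L) (k : L -> M) : subspace U -> linear_on U k ->
    (forall x, U x -> sub_set K (k x)) -> linear_on U (down k).
  move=> [_ sU] kl kU c x y Ux Uy; apply: val_inj.
  rewrite downE; last exact/kU/sU.
  by rewrite -[RHS]/(c *: val (down k x) + val (down k y)) !downE ?kl //; apply: kU.
have down_hom (U : set L) (k : L -> M) : graded_hom_on (lie_span U) k ->
    (forall x, lie_span U x -> sub_set K (k x)) -> graded_hom_on (lie_span U) (down k).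
  move=> [kl kb kd] kU; split.
  - by apply: down_lin => //; apply: lie_span_subspace.
  - move=> x y Ux Uy; apply: val_inj; rewrite downE; last exact/kU/lie_span_lie.
    by rewrite -[RHS]/(lie (val (down k x)) (val (down k y))) !downE ?kb //; apply: kU.
  - move=> n x Ux nx; rewrite -[hcomp _ _]/(hcomp n (val (down k x))) downE; last exact: kU.
    exact: kd.
have sW : subspace W by rewrite -WE; apply/add_span_subspace/subspace0.
have [||||th [[tl tb td] tW tA tB]] :=
    @exists_extension_lf M' (down f) (down g) (down h) _ _ _ _ lfM'.
- exact: down_lin.
- move=> x Wx; rewrite -[hcomp _ _]/(hcomp 1 (val (down f x))) downE; last exact: fK.
  exact: f1.
- exact: down_hom.
- exact: down_hom.
exists (fun x => val (th x)); split.
- split=> [c x y Hx Hy|x y Hx Hy|n x Hx nx]; first by rewrite tl.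
    by rewrite tb.
  exact: (td n x Hx nx).
- by move=> x Wx; rewrite tW ?downE //; apply: fK.
- by move=> x Ax; rewrite tA ?downE //; apply/gK/sub1.
- by move=> x Bx; rewrite tB ?downE //; apply/hK/sub1.
Qed.
End Kurosh.

(** * The theorem *)

Lemma gen1_hom_ext (F : fieldType) (L : gradedLieType F) (T : set L) (M : lieType F)
    (f g : sub_algebra (gen1 T) -> M) :
    lie_hom f -> lie_hom g -> (forall x, T (val x) -> f x = g x) -> f =1 g.
Proof.
move=> [fl fb] [gl gb] fg x.
apply: (lie_span_min (T := [set x | f x = g x])) (gen1_lie_span x).
- split=> [|a y z /= yE zE]; last by rewrite fl gl yE zE.
  rewrite /= (linear_on0 (subspaceT _) (linear_maps_on fl)).
  by rewrite (linear_on0 (subspaceT _) (linear_maps_on gl)).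
- by move=> y z /= yE zE; rewrite fb gb yE zE.
- by move=> y [Ty _] /=; apply: fg.
Qed.

Lemma graded_hom_on_insubd (F : fieldType) (L M : gradedLieType F) (K : gradedSub L)
    (f : sub_algebra K -> M) :
  graded_lie_hom f -> graded_hom_on K (fun x => f (insubd (0 : sub_algebra K) x)).
Proof.
move=> [[fl fb] fd]; have [K0 Kl] := sub_subspace K.
have iE x : sub_set K x -> val (insubd (0 : sub_algebra K) x) = x.
  by move=> Kx; rewrite val_insubd mem_set.
split=> [a x y Kx Ky|x y Kx Ky|n x Kx nx].
- rewrite -fl; congr f; apply: val_inj; rewrite iE; last exact: Kl.
  by rewrite -[RHS]/(a *: val (insubd (0 : sub_algebra K) x) + val (insubd (0 : sub_algebra K) y)) !iE.
- rewrite -fb; congr f; apply: val_inj; rewrite iE; last exact: sub_lie.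
  by rewrite -[RHS]/(lie (val (insubd (0 : sub_algebra K) x)) (val (insubd (0 : sub_algebra K) y))) !iE.
- by apply: fd; rewrite -[hcomp _ _]/(hcomp n (val (insubd (0 : sub_algebra K) x))) iE.
Qed.

Lemma gen1_deg1 (F : fieldType) (L : gradedLieType F) (T : set L) :
  T `<=` hcomp 1 -> sub_set (gen1 T) = lie_span T.
Proof. by move=> T1; rewrite /= setIidl. Qed.

Lemma sub_incl_hom (F : fieldType) (L : gradedLieType F) (K H : gradedSub L)
    (sKH : K `<=` H) : graded_lie_hom (sub_incl sKH).
Proof. by split=> //; split=> [a x y|x y]; apply: val_inj. Qed.

Lemma subspaceI (F : fieldType) (V : lmodType F) (U W : set V) :
  subspace U -> subspace W -> subspace (U `&` W).
Proof.
move=> [U0 Ul] [W0 Wl]; split=> // a x y [Ux Wx] [Uy Wy].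
by split; [apply: Ul | apply: Wl].
Qed.

Lemma lie_hom_range_subspace (F : fieldType) (C L : lieType F) (i : C -> L) :
  lie_hom i -> subspace (range i).
Proof.
move=> [il _]; split.
  by exists 0 => //; rewrite (linear_on0 (subspaceT _) (linear_maps_on il)).
by move=> a _ _ [x _ <-] [y _ <-]; exists (a *: x + y); rewrite ?il.
Qed.

Lemma lie_hom_range_closed (F : fieldType) (C L : lieType F) (i : C -> L) :
  lie_hom i -> lie_closed (range i).
Proof. by move=> [_ ib] _ _ [x _ <-] [y _ <-]; exists (lie x y); rewrite ?ib. Qed.

Definition addset (F : fieldType) (V : lmodType F) (U W : set V) : set V :=
  [set x | exists u w, [/\ U u, W w & x = u + w]].

Lemma subspace_addset (F : fieldType) (V : lmodType F) (U W : set V) :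
  subspace U -> subspace W -> subspace (addset U W).
Proof.
move=> [U0 Ul] [W0 Wl]; split; first by exists 0, 0; rewrite addr0.
move=> c _ _ [u [w [Uu Ww ->]]] [u' [w' [Uu' Ww' ->]]].
exists (c *: u + u'), (c *: w + w').
by split; [apply: Ul | apply: Wl | rewrite scalerDr addrACA].
Qed.

Lemma add_span_addset (F : fieldType) (V : lmodType F) (U : set V) e :
  subspace U -> add_span U e `<=` addset (add_span [set 0] e) U.
Proof.
move=> sU; have [U0 _] := sU; have s0 := subspace0 V.
have se := add_span_subspace e s0; apply: add_span_min.
- exact: subspace_addset.
- by move=> u Uu; exists 0, u; rewrite add0r; split=> //; case: se.
- by move=> x xe; exists x, 0; rewrite addr0; split=> //; apply: mem_add_span.
Qed.

(** By induction, with y added to both subspaces, x is in [V0] up to a multiple of y; since x is in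
    [U] and y is not, that multiple is 0. *)
Lemma free_mod_disjoint (F : fieldType) (V : lmodType F) (V0 U : set V) e :
    subspace V0 -> subspace U -> V0 `<=` U -> free_mod U e ->
  forall x, add_span V0 e x -> U x -> V0 x.
Proof.
elim: e V0 U => [//|y e IHe] V0 U s0 sU V0U /= [Uy fe] x Vx Ux.
have [|||| c Vc _] := IHe (add_line V0 y) (add_line U y) _ _ _ fe x Vx.
- exact: add_line_subspace.
- exact: add_line_subspace.
- apply: add_line_min; [exact: add_line_subspace| |exact: mem_add_line].
  exact: subset_trans (@sub_add_line _ _ _ _).
- exact: sub_add_line.
suff c0 : c = 0 by move: Vc; rewrite c0 scale0r subr0.
apply: (add_line_coef_inj sU Uy (V0U _ Vc)).
by rewrite scale0r subr0.
Qed.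

(** * Subalgebras generated in degree 1 of a free product *)

Section KuroshSubalgebra.
Variables (F : fieldType) (A B L : gradedLieType F) (iA : A -> L) (iB : B -> L).
Hypotheses (gA : one_generated A) (gB : one_generated B).
Hypotheses (finA : fin_spanned (hcomp 1 : set A)) (finB : fin_spanned (hcomp 1 : set B)).
Hypothesis L_AB : is_free_product iA iB.
Variable S : set L.
Hypothesis S1 : S `<=` hcomp 1.

Local Notation H := (gen1 S).
Local Notation H1 := (sub_set H `&` hcomp 1).
Local Notation H1A := (H1 `&` range iA).
Local Notation H1B := (H1 `&` range iB).

Lemma free_product_fin : fin_spanned (hcomp 1 : set L).
Proof.
have [eA eAP] := finA; have [eB eBP] := finB; have [[[iAl _] _] [[iBl _] _] _] := L_AB.
have s0 := subspace0 L; pose e := map iA eA ++ map iB eB.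
have se := add_span_subspace e s0.
have half (C : gradedLieType F) (i : C -> L) (l : seq C) : linear i ->
    {subset map i l <= e} -> forall x, add_span [set 0] l x -> add_span [set 0] e (i x).
  move=> il le; have ilo := linear_maps_on il.
  apply: linear_on_add_span => //; first exact: subspace0.
  - by move=> a x y _ _; apply: il.
  - by move=> x ->; rewrite (linear_on0 (subspaceT _) ilo); case: se.
  - by move=> x xl; apply: mem_add_span => //; apply/le/map_f.
exists e => x x1; have [a [b [a1 b1 ->]]] := free_product_deg1 L_AB gA gB x1.
apply: (subspaceD se); [apply: half iAl _ _ (eAP _ a1)|apply: half iBl _ _ (eBP _ b1)].
  by move=> y ye; rewrite mem_cat ye.
by move=> y ye; rewrite mem_cat ye orbT.
Qed.

Lemma gen1_deg1_subspace : subspace H1.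
Proof. by apply: subspaceI; [apply: sub_subspace | apply: hcomp_subspace]. Qed.

Section Complement.
Variable W : set L.
Hypothesis sW : subspace W.
Hypothesis WAB : forall x, W x -> exists a b, [/\ hcomp 1 a, hcomp 1 b & x = iA a + iB b].
Hypothesis dW : direct_sum3 H1 W H1A H1B.

Let WH : W `<=` H1.
Proof.
have [sH0 _] := gen1_deg1_subspace; have [hA hB _] := L_AB.
have [rA0 _] := lie_hom_range_subspace hA.1; have [rB0 _] := lie_hom_range_subspace hB.1.
by move=> x Wx; apply/dW.1; exists x, 0, 0; rewrite !addr0.
Qed.

Lemma kurosh_extension (M : gradedLieType F) (f g h : L -> M) :
    linear_on W f -> (forall x, W x -> hcomp 1 (f x)) ->
    graded_hom_on (gen1 H1A) g -> graded_hom_on (gen1 H1B) h ->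
  exists theta : L -> M,
  [/\ graded_hom_on H theta, forall x, W x -> theta x = f x,
      forall x, H1A x -> theta x = g x & forall x, H1B x -> theta x = h x].
Proof.
have [hA hB _] := L_AB.
have sH1 := gen1_deg1_subspace.
have sA : subspace H1A := subspaceI sH1 (lie_hom_range_subspace hA.1).
have sB : subspace H1B := subspaceI sH1 (lie_hom_range_subspace hB.1).
have A1 : H1A `<=` hcomp 1 by move=> x [[]].
have B1 : H1B `<=` hcomp 1 by move=> x [[]].
have W1 : W `<=` hcomp 1 by move=> x /WH[].
have [e eL] := free_product_fin.
have [||||w [fw _] wE] := @exists_free_mod _ _ [set 0] W e.
- exact: subspace0.
- exact: sW.
- by move=> x ->; case: sW.
- by move=> x /W1/eL.
have HE : sub_set H = lie_span H1.
  rewrite {1}gen1_deg1 //; apply/seteqP; split; apply: lie_span_min;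
    try exact: lie_span_subspace; try exact: lie_span_lie.
    by move=> x Sx; do 2!(apply: lie_span_gen; split; last exact: S1).
  by move=> x; rewrite gen1_deg1 // => -[].
move=> fl f1; rewrite (gen1_deg1 A1) (gen1_deg1 B1) => gh hh.
have [] := exists_extension L_AB _ _ wE fw W1 sA A1 _ sB B1 _ _ _ _ (H1 := H1)
  _ WH _ _ _ fl f1 gh hh.
- exact: one_generated_locally_finite.
- exact: one_generated_locally_finite.
- by move=> x [].
- by move=> x [].
- by move=> x /WAB[a [b [_ _ ->]]]; exists a, b.
(* For w = iA a + iB b with iA a in [H1A], the element iB b = w - iA a is in [H1B]; directness
   applied to w - iA a - iB b = 0 gives w = 0. *)
- move=> a b Wab Aa; have [_ /(_ (iA a + iB b) (- iA a) (- iB b))[]//] := dW.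
  + exact: subspaceN.
  + apply: subspaceN => //; split; last by exists b.
    by rewrite -[iB b](addKr (iA a)) addrC; apply: (subspaceB sH1); [apply: WH | case: Aa].
  + by rewrite -addrA -opprD subrr.
- move=> a b Wab Bb; have [_ /(_ (iA a + iB b) (- iA a) (- iB b))[]//] := dW.
  + apply: subspaceN => //; split; last by exists a.
    by rewrite -[iA a](addrK (iB b)); apply: (subspaceB sH1); [apply: WH | case: Bb].
  + exact: subspaceN.
  + by rewrite -addrA -opprD subrr.
- by move=> x /dW.1.
- by move=> x [].
- by move=> x [].
- exact: free_product_fin.
by move=> th [thh tW tA tB]; exists th; rewrite {1}HE.
Qed.

(** The target has no grading, so f is placed in degree 1 of t M[t], extended to H together with
    zero maps on the two other factors, evaluated at t = 1 and restricted to the span of [W]. *)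
Lemma kurosh_free : free_on ([set x | W (val x)] : set (sub_algebra (gen1 W))).
Proof.
have W1 : W `<=` hcomp 1 by move=> x /WH[].
split=> [|M f fl].
  by case: sW => W0 Wl; split=> // a x y Wx Wy; apply: Wl.
pose K := gen1 W.
have WK x : W x -> sub_set K x by move=> Wx; apply: lie_span_gen; split=> //; apply: W1.
have iE x : W x -> val (insubd (0 : sub_algebra K) x) = x.
  by move=> /WK Kx; rewrite val_insubd mem_set.
pose f1 x := tmono 1 (f (insubd (0 : sub_algebra K) x)).
have hom0 (U : set L) : graded_hom_on U (fun=> 0 : tpoly M).
  by split=> [a x y _ _|x y _ _|n x _ _] //=; rewrite ?scaler0 ?addr0 ?lie0l.
have [||th [[tl tb _] tW _ _]] := kurosh_extension (f := f1) _ _ (hom0 _) (hom0 _).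
- move=> a x y Wx Wy; apply: tpoly_ext => n; rewrite tcoefD tcoefZ /=.
  case: ifP => _; last by rewrite scaler0 addr0.
  rewrite -fl /=; [|by rewrite iE|by rewrite iE].
  congr f; apply: val_inj; rewrite iE; last by case: sW => _; apply.
  by rewrite -[RHS]/(a *: val (insubd (0 : sub_algebra K) x) + val (insubd (0 : sub_algebra K) y)) !iE.
- by move=> x _ k /eqP/negPf k1 /=; rewrite k1.
have KH : sub_set K `<=` H.
  apply: lie_span_min; [exact: lie_span_subspace|exact: lie_span_lie|].
  by move=> x [/WH[]].
have valK' (x : sub_algebra K) : sub_set H (val x) by apply/KH/set_mem/valP.
pose g (x : sub_algebra K) := teval (th (val x)).
have gh : lie_hom g.
  have [el eb] := teval_lie_hom M.
  split=> [a x y|x y]; rewrite /g; first by rewrite -el -tl.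
  by rewrite -eb -tb.
have gW x : W (val x) -> g x = f x.
  by move=> Wx; rewrite /g tW // /f1 teval_tmono // valKd.
exists g; split=> // g' [g'h g'W]; apply/funext.
by apply: gen1_hom_ext => // x Wx; rewrite gW ?g'W.
Qed.

Lemma kurosh_free_product : internal_free_product3 H (gen1 W) (gen1 H1A) (gen1 H1B).
Proof.
have W1 : W `<=` hcomp 1 by move=> x /WH[].
have sub (U : set L) : U `<=` H1 -> sub_set (gen1 U) `<=` H.
  move=> UH; apply: lie_span_min; [exact: lie_span_subspace|exact: lie_span_lie|].
  by move=> x [/UH[]].
have s1 := sub _ WH.
have s2 : sub_set (gen1 H1A) `<=` H by apply: sub => x [].
have s3 : sub_set (gen1 H1B) `<=` H by apply: sub => x [].
exists s1, s2, s3; split; try exact: sub_incl_hom.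
move=> M f g k fh gh kh.
have [fl fb fd] := graded_hom_on_insubd fh.
have genK (U : set L) : U `<=` H1 -> U `<=` sub_set (gen1 U).
  by move=> UH x Ux; apply: lie_span_gen; split=> //; have [] := UH x Ux.
have [||th [[tl tb td] tW tA tB]] := kurosh_extension
    (f := fun x => f (insubd (0 : sub_algebra (gen1 W)) x)) _ _
    (graded_hom_on_insubd gh) (graded_hom_on_insubd kh).
- by move=> a x y Wx Wy; apply: fl; apply: genK.
- by move=> x Wx; apply: fd; [apply: genK | apply: W1].
have valH (x : sub_algebra H) : sub_set H (val x) by apply/set_mem/valP.
pose t (x : sub_algebra H) := th (val x).
have th_hom : graded_lie_hom t.
  by split; [split=> [a x y|x y]; rewrite /t; [rewrite -tl|rewrite -tb] | move=> n x; apply: td].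
have tincl (K : gradedSub L) (s : K `<=` H) : lie_hom (t \o sub_incl s).
  by apply: lie_hom_comp; [case: th_hom | case: (sub_incl_hom s)].
have tf x : t (sub_incl s1 x) = f x.
  have [fh' _] := fh; move: x; apply: (gen1_hom_ext (tincl _ s1) fh') => x Wx.
  by rewrite -[LHS]/(th (val x)) tW // valKd.
have tg x : t (sub_incl s2 x) = g x.
  have [gh' _] := gh; move: x; apply: (gen1_hom_ext (tincl _ s2) gh') => x Ax.
  by rewrite -[LHS]/(th (val x)) tA // valKd.
have tk x : t (sub_incl s3 x) = k x.
  have [kh' _] := kh; move: x; apply: (gen1_hom_ext (tincl _ s3) kh') => x Bx.
  by rewrite -[LHS]/(th (val x)) tB // valKd.
(* Uniqueness: H is generated by [S], and each element of [S] is a sum of elements of the three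
   factors. *)
exists t; split=> // t' [t'h t'f t'g t'k]; apply/funext.
have [[[tl' _] _] [[tl'' _] _]] := (th_hom, t'h).
apply: gen1_hom_ext; [by case: th_hom | by case: t'h|].
move=> x Sx; have H1x : H1 (val x) by split; [apply: valH | apply: S1].
have [x1 [x2 [x3 [Wx1 Ax2 Bx3 xE]]]] := (dW.1 _).1 H1x.
have m1 : x1 \in sub_set (gen1 W) by apply/mem_set/genK.
have m2 : x2 \in sub_set (gen1 H1A) by apply/mem_set/genK => // y [].
have m3 : x3 \in sub_set (gen1 H1B) by apply/mem_set/genK => // y [].
have -> : x = sub_incl s1 (SubElt m1) + sub_incl s2 (SubElt m2) + sub_incl s3 (SubElt m3).
  exact: val_inj.
rewrite !(linear_onD (linear_maps_on tl')) // !(linear_onD (linear_maps_on tl'')) //.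
by rewrite tf tg tk t'f t'g t'k.
Qed.
End Complement.

Lemma exists_complement : exists2 W : set L, subspace W & direct_sum3 H1 W H1A H1B.
Proof.
have [hA hB _] := L_AB; have sH1 := gen1_deg1_subspace.
have sA : subspace H1A := subspaceI sH1 (lie_hom_range_subspace hA.1).
have sB : subspace H1B := subspaceI sH1 (lie_hom_range_subspace hB.1).
have sU := subspace_addset sA sB; pose U := addset H1A H1B.
have UH : U `<=` H1.
  by move=> _ [a [b [[Ha _] [Hb _] ->]]]; apply: (subspaceD sH1).
have [e eL] := free_product_fin.
have [|e' [fe e'H] eH] := @exists_free_mod _ _ U H1 e sU sH1 UH.
  move=> x [_ /eL]; apply: add_span_min; first exact: add_span_subspace.
    by move=> y ->; case: (add_span_subspace e sU).
  by move=> y ye; apply: mem_add_span.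
pose W := add_span [set 0] e'.
have sW : subspace W := add_span_subspace e' (subspace0 L).
have WH : W `<=` H1.
  by apply: add_span_min => // x ->; case: sH1.
exists W => //; split=> [x|w a b Ww Aa Bb wab0].
  split=> [|[w [a [b [/WH Hw [Ha _] [Hb _] ->]]]]]; last first.
    by do 2!apply: (subspaceD sH1) => //.
  move=> Hx; have : add_span U e' x by rewrite eH.
  move=> /(add_span_addset sU)[w [_ [Ww [a [b [Aa Bb ->]]] ->]]].
  by exists w, a, b; rewrite addrA.
have w0 : w = 0.
  apply: (@free_mod_disjoint _ _ [set 0] U e') => //.
  - exact: subspace0.
  - by move=> y ->; case: sU.
  have -> : w = - (a + b) by apply/eqP; rewrite -addr_eq0 addrA wab0.
  by apply: (subspaceN sU); exists a, b.
move: wab0; rewrite w0 add0r => /eqP; rewrite addr_eq0 => /eqP ab.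
(* The ranges of [iA] and [iB] meet in 0: the retraction onto [A] is injective on the first and
   kills the second. *)
have [rA [rAh rAA rAB]] := free_product_retractl L_AB.
have [x _ ax] := Aa.2; have [y _ yb] := Bb.2.
have rAo := lie_hom_linear_on rAh.1.
have x0 : x = 0.
  by rewrite -(rAA x) ax ab (linear_onN (subspaceT _) rAo) // -yb rAB oppr0.
have a0 : a = 0 by rewrite -ax x0 (linear_on0 (subspaceT _) (lie_hom_linear_on hA.1)).
by split=> //; apply: oppr_inj; rewrite -ab a0 oppr0.
Qed.
End KuroshSubalgebra.

Theorem mainTheorem3 (F : fieldType) (A B L : gradedLieType F)
    (iA : A -> L) (iB : B -> L)
    (bkA : bloch_kato A) (bkB : bloch_kato B)
    (finA : fin_dim (hcomp 1 : set A)) (finB : fin_dim (hcomp 1 : set B))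
    (L_AB : is_free_product iA iB)
    (S : set L) (S_deg1 : S `<=` hcomp 1) :
  let H : gradedSub L := gen1 S in
  let H1 : set L := H `&` hcomp 1 in
  let H1A : set L := H1 `&` range iA in
  let H1B : set L := H1 `&` range iB in
  (exists K KA KB : gradedSub L,
    [/\ exists V : set (sub_algebra K), free_on V,
        KA `<=` range iA, KB `<=` range iB &
        internal_free_product3 H K KA KB]) /\
  (forall W : set L,
    subspace W ->
    (forall w, W w -> exists a b, [/\ hcomp 1 a, hcomp 1 b & w = iA a + iB b]) ->
    direct_sum3 H1 W H1A H1B ->
    free_on ([set x | W (val x)] : set (sub_algebra (gen1 W))) /\
    internal_free_product3 H (gen1 W) (gen1 H1A) (gen1 H1B)).
Proof.
move=> H H1 H1A H1B.
have [[gA _] [gB _]] := (bkA, bkB).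
have fA := fin_dim_spanned finA; have fB := fin_dim_spanned finB.
have free := kurosh_free gA gB fA fB L_AB S_deg1.
have prod := kurosh_free_product gA gB fA fB L_AB S_deg1.
split; last by move=> W sW WAB dW; split; [apply: free | apply: prod].
(* The existence claim is the precise one for some complement W, whose elements split along [A] and
   [B] because they have degree 1. *)
have [W sW dW] := exists_complement gA gB fA fB L_AB S.
have [[hA _] [hB _] _] := L_AB.
have WAB w : W w -> exists a b, [/\ hcomp 1 a, hcomp 1 b & w = iA a + iB b].
  move=> Ww; apply: (free_product_deg1 L_AB gA gB).
  suff [] : H1 w by [].
  apply/dW.1; exists w, 0, 0; rewrite !addr0; split=> //.
    by case: (subspaceI (gen1_deg1_subspace S) (lie_hom_range_subspace hA)).
  by case: (subspaceI (gen1_deg1_subspace S) (lie_hom_range_subspace hB)).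
exists (gen1 W), (gen1 H1A), (gen1 H1B); split; last exact: prod.
- by exists [set x | W (val x)]; apply: free.
- apply: lie_span_min; [exact: lie_hom_range_subspace|exact: lie_hom_range_closed|].
  by move=> x [[_ Ax] _].
- apply: lie_span_min; [exact: lie_hom_range_subspace|exact: lie_hom_range_closed|].
  by move=> x [[_ Bx] _].
Qed.
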